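(* Let $\succ$ be a binary relation on $\mathcal{F}$ admitting a hope-and-prepare representation $(u,C,D)$, i.e. $u:X\to\mathbb{R}$ non-constant affine, $C,D\subseteq\Delta$ convex compact with $C\cap D\neq\emptyset$, and for all $f,g\in\mathcal{F}$: $f\succ g$ iff $\min_{p\in C}\int u(f)\,dp>\min_{p\in C}\int u(g)\,dp$ and $\max_{p\in D}\int u(f)\,dp>\max_{p\in D}\int u(g)\,dp$; assume this representation is unique ($u$ unique up to positive affine transformation, $C$ and $D$ unique). Then: (i) $\succ$ satisfies Axiom A8 if and only if $D\subseteq C$; (ii) $\succ$ satisfies Axiom A9 if and only if $C\subseteq D$. In particular, a binary relation $\succ$ on $\mathcal{F}$ satisfies Axioms A1–A9 if and only if there exist a non-constant affine $u:X\to\mathbb{R}$, unique up to positive affine transformation, and a unique convex compact $C\subseteq\Delta$ such that for all $f,g\in\mathcal{F}$, $$f\succ g\iff \begin{cases}\min_{p\in C}\int u(f)\,dp>\min_{p\in C}\int u(g)\,dp,\\ \max_{p\in C}\int u(f)\,dp>\max_{p\in C}\int u(g)\,dp.\end{cases}$$ Axioms: (A1) $\succ$ is asymmetric and transitive, and its restriction to $X$ is non-trivial and negatively transitive. (A2) For all $f,g,h\in\mathcal{F}$, $\{\alpha\in[0,1]:\alpha f+(1-\alpha)g\succ h\}$ and $\{\alpha\in[0,1]:h\succ\alpha f+(1-\alpha)g\}$ are open in $[0,1]$. (A3) For all $f,g\in\mathcal{F}$, $x\in X$, $\alpha\in(0,1)$: $f\succ g$ iff $\alpha f+(1-\alpha)x\succ\alpha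 g+(1-\alpha)x$. (A4) For all $x\in X$, $\{f:f\succ x\}$ and $\{f:x\succ f\}$ are convex. (A5) If $f(s)\succ g(s)$ for all $s\in S$ then $f\succ g$. (A6) If for all $x\in X$, $f\Join x$ implies $g\Join x$, then $f\Join g$. (A7) If $f\Join x$, $x\succ g$, $g\Join y$, $f\succ y$ (with $x,y\in X$), then $f\succ g$. (A8) If $f,g\in\mathcal{F}$ are complementary, then $f\succ\frac12 f+\frac12 g$ implies $\frac12 f+\frac12 g\succ g$. (A9) If $f,g\in\mathcal{F}$ are complementary, then $\frac12 f+\frac12 g\succ g$ implies $f\succ\frac12 f+\frac12 g$.
   Context: $S$ is a set of states with algebra $\Sigma$; $X$ is a non-singleton convex subset of a real vector space; $\mathcal{F}$ is the set of simple ($\Sigma$-measurable, finitely-valued) acts $f:S\to X$, with pointwise mixtures; each $x\in X$ is identified with the corresponding constant act. $\Delta$ is the set of finitely additive probability measures on $(S,\Sigma)$ with the weak* topology. $f\Join g$ means $f\not\succ g$ and $g\not\succ f$. On $X$, write $x\sim y$ iff $x\Join y$. Two acts $f,g$ are complementary if $\frac12 f(s)+\frac12 g(s)\sim\frac12 f(s')+\frac12 g(s')$ for all $s,s'\in S$. *)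

(* Defs.v *)
From HB Require Import structures.
From mathcomp Require Import all_boot all_order all_algebra.
From mathcomp Require Import all_classical all_reals all_analysis.
Set Implicit Arguments. Unset Strict Implicit. Unset Printing Implicit Defensive.
Import Order.TTheory GRing.Theory Num.Theory.
Import numFieldNormedType.Exports.
Local Open Scope classical_set_scope.
Local Open Scope ring_scope.

Section Defs.
Variables (R : realType) (V : lmodType R) (S : Type).

Definition is_algebra (Sigma : set (set S)) : Prop :=
  Sigma setT /\ (forall A, Sigma A -> Sigma (~` A)) /\
  (forall A B, Sigma A -> Sigma B -> Sigma (A `|` B)).

Definition convex_subset (X : set V) : Prop :=
  forall x y a, X x -> X y -> 0 <= a <= 1 -> X (a *: x + (1 - a) *: y).

Definition nonsingleton (X : set V) : Prop :=
  exists x y, X x /\ X y /\ x <> y.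

Definition act := S -> V.
Definition cst (x : V) : act := fun _ => x.
Definition mix (a : R) (f g : act) : act := fun s => a *: f s + (1 - a) *: g s.

Definition simple_act (Sigma : set (set S)) (X : set V) (f : act) : Prop :=
  (forall s, X (f s)) /\ finite_set (range f) /\
  (forall x, Sigma (f @^-1` [set x])).

(* finitely additive probability measures on (S, Sigma); convention: value 0
   on non-Sigma sets, so each element of Delta is determined by its values on
   Sigma *)
Definition fa_prob (Sigma : set (set S)) (p : set S -> R) : Prop :=
  (forall A, Sigma A -> 0 <= p A) /\ p setT = 1 /\
  (forall A B, Sigma A -> Sigma B -> A `&` B = set0 ->
     p (A `|` B) = p A + p B) /\
  (forall A, ~ Sigma A -> p A = 0).

Definition integ (u : V -> R) (p : set S -> R) (f : act) : R :=
  \sum_(x \in range f) u x * p (f @^-1` [set x]).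

Definition minE (u : V -> R) (C : set (set S -> R)) (f : act) : R :=
  inf [set integ u p f | p in C].
Definition maxE (u : V -> R) (C : set (set S -> R)) (f : act) : R :=
  sup [set integ u p f | p in C].

Definition affine_on (X : set V) (u : V -> R) : Prop :=
  forall x y a, X x -> X y -> 0 <= a <= 1 ->
    u (a *: x + (1 - a) *: y) = a * u x + (1 - a) * u y.

Definition nonconstant_on (X : set V) (u : V -> R) : Prop :=
  exists x y, X x /\ X y /\ u x <> u y.

Definition convex_prob_set (C : set (set S -> R)) : Prop :=
  forall p q a, C p -> C q -> 0 <= a <= 1 ->
    C (fun A => a * p A + (1 - a) * q A).

(* weak* compactness: pointwise (setwise) topology *)
Definition wcompact (C : set (set S -> R)) : Prop :=
  @compact {ptws set S -> (R : topologicalType)} C.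

Definition good_prob_set (Sigma : set (set S)) (C : set (set S -> R)) : Prop :=
  C `<=` fa_prob Sigma /\ convex_prob_set C /\ wcompact C.

Variables (Sigma : set (set S)) (X : set V).
Notation F := (simple_act Sigma X).

Definition HP_rep (pref : act -> act -> Prop) (u : V -> R)
    (C D : set (set S -> R)) : Prop :=
  affine_on X u /\ nonconstant_on X u /\
  good_prob_set Sigma C /\ good_prob_set Sigma D /\ C `&` D !=set0 /\
  forall f g, F f -> F g ->
    (pref f g <-> (minE u C g < minE u C f /\ maxE u D g < maxE u D f)).

Definition pos_affine_transf (u u' : V -> R) : Prop :=
  exists a b : R, 0 < a /\ forall x, X x -> u' x = a * u x + b.

Definition HP_unique (pref : act -> act -> Prop) (u : V -> R)
    (C D : set (set S -> R)) : Prop :=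
  forall u' C' D', HP_rep pref u' C' D' ->
    pos_affine_transf u u' /\ C' = C /\ D' = D.

Definition indiff (pref : act -> act -> Prop) (f g : act) : Prop :=
  ~ pref f g /\ ~ pref g f.

Definition complementary (pref : act -> act -> Prop) (f g : act) : Prop :=
  forall s s', indiff pref (cst (2^-1 *: f s + 2^-1 *: g s))
                           (cst (2^-1 *: f s' + 2^-1 *: g s')).

Section Conds.
Variable pref : act -> act -> Prop.
Local Notation "f ≻ g" := (pref f g) (at level 70).
Local Notation "f ⋈ g" := (indiff pref f g) (at level 70).

Definition A1 : Prop :=
  (forall f g, F f -> F g -> f ≻ g -> ~ g ≻ f) /\
  (forall f g h, F f -> F g -> F h -> f ≻ g -> g ≻ h -> f ≻ h) /\
  (exists x y, X x /\ X y /\ cst x ≻ cst y) /\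
  (forall x y z, X x -> X y -> X z ->
     ~ cst x ≻ cst y -> ~ cst y ≻ cst z -> ~ cst x ≻ cst z).

Definition open01 (P : R -> Prop) : Prop :=
  forall a, 0 <= a <= 1 -> P a ->
    exists e, 0 < e /\ forall b, 0 <= b <= 1 -> `|b - a| < e -> P b.

Definition A2 : Prop :=
  forall f g h, F f -> F g -> F h ->
    open01 (fun a => mix a f g ≻ h) /\ open01 (fun a => h ≻ mix a f g).

Definition A3 : Prop :=
  forall f g x a, F f -> F g -> X x -> 0 < a < 1 ->
    (f ≻ g <-> mix a f (cst x) ≻ mix a g (cst x)).

Definition A4 : Prop :=
  forall x, X x ->
    (forall f g a, F f -> F g -> 0 <= a <= 1 ->
       f ≻ cst x -> g ≻ cst x -> mix a f g ≻ cst x) /\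
    (forall f g a, F f -> F g -> 0 <= a <= 1 ->
       cst x ≻ f -> cst x ≻ g -> cst x ≻ mix a f g).

Definition A5 : Prop :=
  forall f g, F f -> F g -> (forall s, cst (f s) ≻ cst (g s)) -> f ≻ g.

Definition A6 : Prop :=
  forall f g, F f -> F g ->
    (forall x, X x -> f ⋈ cst x -> g ⋈ cst x) -> f ⋈ g.

Definition A7 : Prop :=
  forall f g x y, F f -> F g -> X x -> X y ->
    f ⋈ cst x -> cst x ≻ g -> g ⋈ cst y -> f ≻ cst y -> f ≻ g.

Definition A8 : Prop :=
  forall f g, F f -> F g -> complementary pref f g ->
    f ≻ mix 2^-1 f g -> mix 2^-1 f g ≻ g.

Definition A9 : Prop :=
  forall f g, F f -> F g -> complementary pref f g ->
    mix 2^-1 f g ≻ g -> f ≻ mix 2^-1 f g.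

End Conds.
End Defs.

(* Main.v *)
Require Import Defs.
From mathcomp Require Import all_boot all_order all_algebra.
From mathcomp Require Import all_classical all_reals all_analysis.
From mathcomp Require Import ring lra.
Set Implicit Arguments. Unset Strict Implicit. Unset Printing Implicit Defensive.
Import Order.TTheory GRing.Theory Num.Theory.
Import numFieldNormedType.Exports.
Local Open Scope classical_set_scope.
Local Open Scope ring_scope.

(** Write I phi for the minimum over C and K phi for the minimum over D of the
    integral of a simple function phi, so that the maximum over D of phi is
    - K (- phi). For complementary acts f, g with constant utility k of the
    midpoint, f is preferred to the midpoint iff k < I (u f), and the midpoint is
    preferred to g iff k < K (u f): hence A8 says I <= K and A9 says K <= I on
    simple functions, and by separation these mean D <= C and C <= D.

    Conversely A1-A3 give an affine utility on X (von Neumann-Morgenstern), and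
    A2, A3, A5 let the preference descend to utility profiles and extend to all
    simple functions. The constants not comparable to phi form an interval
    [I phi, J phi]; A4 makes I superlinear, A6 and A7 say that phi is preferred to
    psi iff both endpoints are larger, and A8, A9 give J phi = - I (- phi). Finally
    a superlinear, monotone, normalized I is the lower envelope of the compact
    convex set of finitely additive probabilities dominating it, which is tight by
    Hahn-Banach (obtained from maximal superlinear functionals). *)

(** * Simple functions and their integral *)

Section SimpleFunctions.
Variables (R : realType) (S : Type) (Sigma : set (set S)).
Hypothesis algS : is_algebra Sigma.

(** Apart from being nonempty, [C] and [D] enter the study of the axioms only through their lower
    envelopes, and a common point only through [I phi + K (- phi) <= 0]. This inequality makes
    comparison with a constant depend on a single endpoint, which is why the axioms about constants
    can isolate [I] from [K]. Two obstacles shape the converse. The range of [u] may be a bounded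
    interval, so that not every simple function is a utility profile, and an act may take a best or
    worst value of [X], which leaves no room for the strict dominance that A5 demands. Mixing with a
    fixed interior point cures both, since A3 makes it harmless; the same device places every point
    of [X] on the scale between two reference points when the utility is built. For the separation
    of a probability from a compact convex set, the setwise topology reduces everything to finitely
    many coordinates, where Euclidean projection suffices; the extension of functionals is needed
    only to show that envelopes are attained. *)

Definition simple_fun (T : Type) (f : S -> T) : Prop :=
  finite_set (range f) /\ forall x, Sigma (f @^-1` [set x]).

Lemma algebra0 : Sigma set0.
Proof. by case: algS => T [C _]; rewrite -setCT; exact: C. Qed.

Lemma algebraI A B : Sigma A -> Sigma B -> Sigma (A `&` B).
Proof.
move=> SA SB; case: algS => _ [C U].
by rewrite -(setCK (A `&` B)) setCI; apply: (C); apply: U; exact: C.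
Qed.

Lemma preimage_set_cons (T : eqType) (f : S -> T) (x : T) (s : seq T) :
  f @^-1` [set` x :: s] = f @^-1` [set x] `|` f @^-1` [set` s].
Proof.
apply/seteqP; split => t /=; rewrite inE; first by case/orP=> [/eqP|]; [left|right].
by case=> [->|->]; rewrite ?eqxx ?orbT.
Qed.

Lemma algebra_preimage_seq (T : eqType) (f : S -> T) (s : seq T) :
  simple_fun f -> Sigma (f @^-1` [set` s]).
Proof.
move=> [_ mf]; elim: s => [|x s IH].
  by rewrite set_nil preimage_set0; exact: algebra0.
rewrite preimage_set_cons; case: algS => _ [_]; exact.
Qed.

Lemma simple_fun_comp (T T' : choiceType) (k : T -> T') (f : S -> T) :
  simple_fun f -> simple_fun (k \o f).
Proof.
move=> sf; have [ff mf] := sf; split.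
  by rewrite -(image_comp f k); exact: finite_image.
move=> y; have /finite_seqP[s rs] := ff.
have -> : (k \o f) @^-1` [set y] = f @^-1` [set` [seq x <- s | k x == y]].
  apply/seteqP; split=> t /=; rewrite mem_filter.
    move=> <-; rewrite eqxx /=.
    by have : range f (f t) by []; rewrite rs.
  by move=> /andP[/eqP].
exact: algebra_preimage_seq.
Qed.

Lemma simple_fun_pair (T T' : Type) (f : S -> T) (g : S -> T') :
  simple_fun f -> simple_fun g -> simple_fun (fun s => (f s, g s)).
Proof.
move=> [ff mf] [fg mg]; split.
  apply: sub_finite_set (finite_setX ff fg) => _ [s _ <-].
  by split; exists s.
move=> [x y].
have -> : (fun s => (f s, g s)) @^-1` [set (x, y)] =
          f @^-1` [set x] `&` g @^-1` [set y].
  by apply/seteqP; split => t /= [-> ->].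
exact: algebraI.
Qed.

Lemma simple_fun_cst (T : Type) (x : T) : simple_fun (fun=> x).
Proof.
split; first by apply: sub_finite_set (finite_set1 x) => _ [s _ <-].
move=> y; have [->|xy] := pselect (x = y).
  rewrite (_ : _ @^-1` _ = setT); first by case: algS.
  by apply/seteqP; split.
rewrite (_ : _ @^-1` _ = set0); first exact: algebra0.
by apply/seteqP; split.
Qed.

Lemma simple_fun2 (T T' T'' : choiceType) (k : T -> T' -> T'')
    (f : S -> T) (g : S -> T') :
  simple_fun f -> simple_fun g -> simple_fun (fun s => k (f s) (g s)).
Proof.
move=> sf sg.
exact: (simple_fun_comp (fun xy => k xy.1 xy.2) (simple_fun_pair sf sg)).
Qed.

Lemma simple_fun_indic A : Sigma A -> simple_fun (\1_A : S -> R).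
Proof.
move=> SA; split.
  apply: (@sub_finite_set _ _ [set` [:: 0; 1 : R]]); last exact: finite_seq.
  move=> _ [s _ <-]; rewrite /= !inE indicE.
  by case: (_ \in _); rewrite eqxx ?orbT.
move=> x; case: algS => _ [C _].
have [->|x1] := eqVneq x 1.
  rewrite (_ : _ @^-1` _ = A)//; apply/seteqP; split => s /=; rewrite indicE.
    by case: (boolP (s \in A)) => [/set_mem//|_ /eqP]; rewrite eq_sym oner_eq0.
  by move=> As; rewrite mem_set.
have [->|x0] := eqVneq x 0.
  rewrite (_ : _ @^-1` _ = ~` A)//; first exact: C.
  apply/seteqP; split => s /=; rewrite indicE.
    by move=> + As; rewrite mem_set// => /eqP; rewrite oner_eq0.
  by move=> As; rewrite memNset.
rewrite (_ : _ @^-1` _ = set0)//; first exact: algebra0.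
apply/seteqP; split => s //=; rewrite indicE.
by move=> sx; move: x1 x0; rewrite -sx; case: (_ \in _); rewrite eqxx.
Qed.

Section Integral.
Variable p : set S -> R.
Hypothesis pP : fa_prob Sigma p.

Lemma fa_prob0 : p set0 = 0.
Proof.
have [_ [_ [pU _]]] := pP.
have := pU set0 set0 algebra0 algebra0 (setI0 _).
by rewrite setU0 => /eqP; rewrite addrC -subr_eq subrr => /eqP.
Qed.

(** [S] is not assumed inhabited, but on an empty [S] the full set would have mass both 1 and 0. *)
Lemma fa_prob_inhabited : exists s : S, True.
Proof.
apply: contrapT => noS; have [_ [p1 _]] := pP.
have T0 : setT = set0 :> set S by apply/seteqP; split => s // _; apply: noS; exists s.
by move: p1; rewrite T0 fa_prob0 => /eqP; rewrite eq_sym oner_eq0.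
Qed.

Lemma fa_prob_preimage_seq (T : eqType) (f : S -> T) (s : seq T) :
  simple_fun f -> uniq s ->
  p (f @^-1` [set` s]) = \sum_(x <- s) p (f @^-1` [set x]).
Proof.
move=> sf; have [_ [_ [pU _]]] := pP; elim: s => [_|x s IH /= /andP[xs us]].
  by rewrite big_nil set_nil preimage_set0 fa_prob0.
rewrite big_cons -IH// preimage_set_cons pU//.
- by case: sf.
- exact: algebra_preimage_seq.
- by apply/seteqP; split => t //= [-> sx]; rewrite sx in xs.
Qed.

(** The integrand is split into a simple map [f] and a weight [u] on its values, so that integrals
    of several functions of [f] become sums over one range. *)
Definition fint (T : choiceType) (u : T -> R) (f : S -> T) : R :=
  \sum_(x \in range f) u x * p (f @^-1` [set x]).

Lemma fint_seq (T : choiceType) (u : T -> R) (f : S -> T) (s : seq T) :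
  uniq s -> range f `<=` [set` s] ->
  fint u f = \sum_(x <- s) u x * p (f @^-1` [set x]).
Proof.
move=> us fs; rewrite fsbig_seq//; apply: fsbig_widen => // x [_ /= nx].
rewrite (_ : _ @^-1` _ = set0) ?fa_prob0 ?mulr0//.
by apply/seteqP; split => t //= ftx; apply: nx; exists t.
Qed.

Lemma simple_fun_seq (T : choiceType) (f : S -> T) : simple_fun f ->
  exists2 s : seq T, uniq s & range f = [set` s].
Proof.
case=> /finite_seqP[s rs] _; exists (undup s); first exact: undup_uniq.
by rewrite rs; apply/seteqP; split => x /=; rewrite mem_undup.
Qed.

(** Change of variables: the fibre of [k \o f] over [y] is the disjoint union of the fibres of [f]
    over the points that [k] sends to [y], so finite additivity regroups the sum. *)
Lemma fint_comp (T T' : choiceType) (u : T' -> R) (k : T -> T') (f : S -> T) :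
  simple_fun f -> fint u (k \o f) = fint (u \o k) f.
Proof.
move=> sf; have [s us rs] := simple_fun_seq sf.
rewrite (@fint_seq _ (u \o k) f s) ?rs//.
rewrite (@fint_seq _ u _ (undup (map k s))) ?undup_uniq//; last first.
  move=> _ [t _ <-] /=; rewrite mem_undup; apply: map_f.
  by have : range f (f t) by []; rewrite rs.
under eq_bigr => y _.
  have -> : (k \o f) @^-1` [set y] = f @^-1` [set` [seq x <- s | k x == y]].
    apply/seteqP; split=> t /=; rewrite mem_filter.
      move=> <-; rewrite eqxx /=.
      by have : range f (f t) by []; rewrite rs.
    by move=> /andP[/eqP].
  rewrite fa_prob_preimage_seq ?filter_uniq// big_filter mulr_sumr.
  over.
rewrite (exchange_big_dep xpredT) //=.
apply: eq_big_seq => x xs.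
rewrite big_mkcond (bigD1_seq (k x)) ?undup_uniq ?mem_undup ?map_f//=.
by rewrite eqxx big1 ?addr0// => y; rewrite eq_sym => /negPf ->.
Qed.

Definition sint (phi : S -> R) : R := fint id phi.

Lemma integE (V : lmodType R) (u : V -> R) (f : S -> V) :
  simple_fun f -> integ u p f = sint (u \o f).
Proof. by move=> sf; rewrite /sint fint_comp. Qed.

Lemma sintD phi psi : simple_fun phi -> simple_fun psi ->
  sint (fun s => phi s + psi s) = sint phi + sint psi.
Proof.
(* Both summands and their sum are functions of the pair [(phi, psi)], so all three integrals are
   sums over the range of one simple map. *)
move=> sp sq; have spq := simple_fun_pair sp sq.
rewrite /sint (fint_comp id (fun xy : R * R => xy.1 + xy.2) spq).
rewrite (fint_comp id (fun xy : R * R => xy.1) spq).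
rewrite (fint_comp id (fun xy : R * R => xy.2) spq).
rewrite /fint -fsbig_split; last by case: spq.
by apply: eq_fsbigr => x _ /=; rewrite mulrDl.
Qed.

Lemma sintZ a phi : simple_fun phi -> sint (fun s => a * phi s) = a * sint phi.
Proof.
move=> sp; rewrite /sint (fint_comp id (fun x : R => a * x) sp) /fint mulr_fsumr.
by apply: eq_fsbigr => x _ /=; rewrite mulrA.
Qed.

Lemma sint_cst c : sint (fun=> c) = c.
Proof.
have [s _] := fa_prob_inhabited; have [_ [p1 _]] := pP.
rewrite /sint (@fint_seq _ id _ [:: c])//; last first.
  by move=> _ [t _ <-] /=; rewrite inE.
rewrite big_seq1 /= (_ : _ @^-1` _ = setT) ?p1 ?mulr1//.
by apply/seteqP; split.
Qed.

Lemma sintN phi : simple_fun phi -> sint (fun s => - phi s) = - sint phi.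
Proof.
move=> sp; rewrite -mulN1r -sintZ//; congr sint.
by apply/funext => s; rewrite mulN1r.
Qed.

Lemma sint_ge0 phi : simple_fun phi -> (forall s, 0 <= phi s) -> 0 <= sint phi.
Proof.
move=> [_ mp] p0; apply: fsumr_ge0 => _ [s _ <-]; apply: mulr_ge0 => //.
by case: pP => + _; apply; exact: mp.
Qed.

Lemma sint_le phi psi : simple_fun phi -> simple_fun psi ->
  (forall s, phi s <= psi s) -> sint phi <= sint psi.
Proof.
move=> sp sq le; rewrite -subr_ge0 -sintN// -sintD//; last first.
  exact: (simple_fun_comp (fun x => - x)).
apply: sint_ge0; last by move=> s; rewrite subr_ge0.
exact: (simple_fun2 (fun x y => x - y)).
Qed.

Lemma sint_indic A : Sigma A -> sint (\1_A) = p A.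
Proof.
move=> SA; rewrite /sint (@fint_seq _ id _ [:: 0; 1])//; last 2 first.
- by rewrite /= inE eq_sym oner_eq0.
- move=> _ [s _ <-]; rewrite /= !inE indicE.
  by case: (_ \in _); rewrite eqxx ?orbT.
rewrite big_cons big_seq1 mul0r add0r mul1r; congr p.
apply/seteqP; split => s /=; rewrite indicE.
  by case: (boolP (s \in A)) => [/set_mem//|_ /eqP]; rewrite eq_sym oner_eq0.
by move=> As; rewrite mem_set.
Qed.

End Integral.

Lemma simple_fun_bounded (phi : S -> R) : simple_fun phi ->
  exists2 M, 0 < M & forall s, `|phi s| <= M.
Proof.
case=> /finite_seqP[r rr] _.
exists (1 + \sum_(x <- r) `|x|).
  by apply: ltr_pwDl => //; apply: sumr_ge0.
move=> s; have : range phi (phi s) by []; rewrite rr /= => sr.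
rewrite (big_rem _ sr) /= addrCA lerDl addr_ge0//.
by apply: sumr_ge0.
Qed.

Lemma simple_fun_decomp (phi : S -> R) (r : seq R) (s : S) :
  uniq r -> range phi `<=` [set` r] ->
  phi s = \sum_(x <- r) x * \1_(phi @^-1` [set x]) s.
Proof.
move=> ur sr; have rs : phi s \in r by apply: sr.
rewrite (bigD1_seq (phi s)) //= indicE mem_set// mulr1 big1 ?addr0//.
move=> x xs; rewrite indicE memNset ?mulr0// => /= ps.
by rewrite ps eqxx in xs.
Qed.

End SimpleFunctions.

(** * The topology of setwise convergence *)

Section SetFunctionTopology.
Variables (R : realType) (S : Type).
Notation M := {ptws set S -> (R : topologicalType)}.

Lemma continuous_eval (A : set S) : continuous (fun p : M => p A).
Proof. exact: (@proj_continuous (set S) (fun=> R) A). Qed.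

Lemma continuous_sum (T : topologicalType) (I : Type) (r : seq I)
    (F : I -> T -> R) :
  (forall i, continuous (F i)) -> continuous (fun x => \sum_(i <- r) F i x).
Proof.
move=> cF; elim: r => [|i r IH].
  by under eq_fun do rewrite big_nil; move=> x; exact: cvg_cst.
by under eq_fun do rewrite big_cons; move=> x; apply: cvgD; [exact: cF|exact: IH].
Qed.

Lemma continuous_scale (T : topologicalType) (a : R) (f : T -> R) :
  continuous f -> continuous (fun x => a * f x).
Proof. by move=> cf x; apply: cvgM; [exact: cvg_cst|exact: cf]. Qed.

Lemma continuous_add (T : topologicalType) (f g : T -> R) :
  continuous f -> continuous g -> continuous (fun x => f x + g x).
Proof. by move=> cf cg x; apply: cvgD; [exact: cf|exact: cg]. Qed.

Lemma continuous_sint (phi : S -> R) : finite_set (range phi) ->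
  continuous (fun p : M => sint p phi).
Proof.
move=> fp; pose F (x : R) (p : M) : R := x * p (phi @^-1` [set x]).
have -> : (fun p : M => sint p phi) =
          (fun p : M => \sum_(x <- finmap.enum_fset (fset_set (range phi))) F x p).
  by apply/funext => p; rewrite /sint /fint fsbig_finite.
apply: (@continuous_sum M) => x.
exact (@continuous_scale M x _ (@continuous_eval (phi @^-1` [set x]))).
Qed.

Lemma closed_ge_fun (T : topologicalType) (f : T -> R) a :
  continuous f -> closed [set x | a <= f x].
Proof. by move=> cf; apply: ((continuous_closedP f).1 cf) (@closed_ge R a). Qed.

Lemma closed_eq_fun (T : topologicalType) (f : T -> R) a :
  continuous f -> closed [set x | f x = a].
Proof. by move=> cf; apply: ((continuous_closedP f).1 cf) (@closed_eq R a). Qed.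

Lemma closed_fa_prob (Sigma : set (set S)) : @closed M (fa_prob Sigma).
Proof.
have -> : fa_prob Sigma =
  (\bigcap_(A in Sigma) [set p : M | 0 <= p A]) `&`
  ([set p : M | p setT = 1] `&`
  ((\bigcap_(AB in [set AB | [/\ Sigma AB.1, Sigma AB.2 & AB.1 `&` AB.2 = set0]])
    [set p : M | p (AB.1 `|` AB.2) + -1 * (p AB.1 + p AB.2) = 0]) `&`
  (\bigcap_(A in ~` Sigma) [set p : M | p A = 0]))).
  apply/seteqP; split => p.
    move=> [p0 [p1 [pU pN]]]; split; first exact: p0.
    split=> //; split; last exact: pN.
    by move=> [A B] [/= SA SB AB]; rewrite pU// mulN1r subrr.
  move=> [p0 [p1 [pU pN]]]; split; first exact: p0.
  split=> //; split; last exact: pN.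
  move=> A B SA SB AB; apply/eqP; rewrite -subr_eq0 -mulN1r; apply/eqP.
  exact: (pU (A, B)).
apply: closedI.
  by apply: closed_bigI => A _; apply: (@closed_ge_fun M _ _ (@continuous_eval A)).
apply: closedI; first by apply: (@closed_eq_fun M _ _ (@continuous_eval setT)).
apply: closedI; last first.
  by apply: closed_bigI => A _; apply: (@closed_eq_fun M _ _ (@continuous_eval A)).
apply: closed_bigI => -[A B] _; apply: (@closed_eq_fun M).
apply: (@continuous_add M _ _ (@continuous_eval (A `|` B))).
apply: (@continuous_scale M (-1)).
by apply: (@continuous_add M); exact: continuous_eval.
Qed.

Lemma compact_unit_cube : @compact M [set p | forall A, p A \in `[0, 1]].
Proof.
apply: (@tychonoff (set S) (fun=> R) (fun=> [set x | x \in `[0, 1]])) => A.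
exact: segment_compact.
Qed.

(** Compactness is used in its covering form, along the filter of finite lists directed by
    inclusion: each [q] in [C] differs from [p] at some [A], and this persists for all points near
    [q] and all lists containing [A]. *)
Lemma compact_finite_separation (C : set (set S -> R)) (p : set S -> R) :
  wcompact C -> ~ C p ->
  exists r : seq (set S), forall q, C q -> exists2 A, A \in r & q A != p A.
Proof.
move=> /compact_near_coveringP cC nCp.
pose F : set_system (seq (set S)) :=
  [set P : set (seq (set S)) | exists r0 : seq (set S),
    forall r : seq (set S), {subset r0 <= r} -> P r].
have FF : Filter F.
  split=> [|P Q [r0 Pr] [r1 Qr]|P Q PQ [r0 Pr]].
  - by exists [::].
  - exists (r0 ++ r1) => r rr; split; [apply: Pr|apply: Qr] => A Ar;
      by apply: rr; rewrite mem_cat Ar ?orbT.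
  - by exists r0 => r /Pr /PQ.
have [q Cq|r0 Pr] :=
    cC _ F (fun (r : seq (set S)) (q : M) => exists2 A, A \in r & q A != p A) FF.
  have [A qA] : exists A, q A != p A.
    apply: contrapT => nq; apply: nCp; suff -> : p = q by [].
    apply/funext => A; apply/eqP; rewrite eq_sym; apply: contrapT => pq.
    by apply: nq; exists A; apply/negP.
  exists ([set q' : M | q' A != p A], [set r : seq (set S) | A \in r]); last first.
    by move=> [q' r] [/= qA' Ar]; exists A.
  split => /=; last by exists [:: A] => r rr; apply: rr; rewrite inE.
  apply: open_nbhs_nbhs; split => //; rewrite -closedC.
  rewrite (_ : ~` _ = [set q : M | q A = p A]).
    exact: (@closed_eq_fun M _ _ (@continuous_eval A)).
  by apply/seteqP; split => q' /=; [move/negP/negPn/eqP|move=> ->; rewrite eqxx].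
by exists r0 => q Cq; exact: Pr Cq.
Qed.

End SetFunctionTopology.

(** * Superlinear functionals and lower envelopes *)

Section Superlinear.
Variables (R : realType) (S : Type) (Sigma : set (set S)).
Hypothesis algS : is_algebra Sigma.
Notation L := (@simple_fun S Sigma R).

Lemma simple_funD phi psi : L phi -> L psi -> L (fun s => phi s + psi s).
Proof. exact: (simple_fun2 algS (fun x y : R => x + y)). Qed.

Lemma simple_funZ a phi : L phi -> L (fun s => a * phi s).
Proof. exact: (simple_fun_comp algS (fun x : R => a * x)). Qed.

Lemma simple_funN phi : L phi -> L (fun s => - phi s).
Proof. exact: (simple_fun_comp algS (fun x : R => - x)). Qed.

Lemma simple_funDc c phi : L phi -> L (fun s => phi s + c).
Proof. exact: (simple_fun_comp algS (fun x : R => x + c)). Qed.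

Lemma simple_fun_sum (J : Type) (r : seq J) (F : J -> S -> R) :
  (forall j, L (F j)) -> L (fun s => \sum_(j <- r) F j s).
Proof.
move=> LF; elim: r => [|j r IH].
  by under eq_fun do rewrite big_nil; exact: simple_fun_cst.
by under eq_fun do rewrite big_cons; exact: simple_funD.
Qed.

Definition superlinear (I : (S -> R) -> R) : Prop :=
  (forall phi psi, L phi -> L psi ->
     I phi + I psi <= I (fun s => phi s + psi s)) /\
  (forall a phi, 0 <= a -> L phi -> I (fun s => a * phi s) = a * I phi).

(** These functionals are the coherent lower previsions on simple functions. *)
Definition expectation_like (I : (S -> R) -> R) : Prop :=
  superlinear I /\
  (forall phi psi, L phi -> L psi -> (forall s, phi s <= psi s) ->
     I phi <= I psi) /\
  (forall c, I (fun=> c) = c).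

Lemma superlinear0 I : superlinear I -> I (fun=> 0) = 0.
Proof.
move=> [_ Iz]; have := Iz 0 (fun=> 0) (lexx _) (simple_fun_cst algS 0).
by under eq_fun do rewrite mul0r; rewrite mul0r.
Qed.

Lemma superlinearN I phi : superlinear I -> L phi ->
  I phi + I (fun s => - phi s) <= 0.
Proof.
move=> sI Lp; rewrite -(superlinear0 sI); case: (sI) => Ia _.
apply: le_trans (Ia _ _ Lp (simple_funN Lp)) _.
by under eq_fun do rewrite subrr.
Qed.

(** Superadditivity against the constant [c] gives one inequality; undoing the shift with [- c]
    gives the other. *)
Lemma expectation_like_translate I c phi : expectation_like I -> L phi ->
  I (fun s => phi s + c) = I phi + c.
Proof.
move=> [[Ia _] [_ Ic]] Lp; apply/eqP; rewrite eq_le; apply/andP; split.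
  rewrite -lerBlDr -{1}(Ic (- c)).
  apply: le_trans (Ia _ _ (simple_funDc c Lp) (simple_fun_cst algS _)) _.
  by under eq_fun do rewrite addrK.
by rewrite -{1}(Ic c); exact: (Ia _ _ Lp (simple_fun_cst algS _)).
Qed.

Lemma expectation_like_le_add I e phi psi : expectation_like I ->
  L phi -> L psi -> (forall s, phi s <= psi s + e) -> I phi <= I psi + e.
Proof.
move=> eI Lp Lq le; rewrite -expectation_like_translate//.
by case: eI => _ [Im _]; apply: Im => //; exact: simple_funDc.
Qed.

Lemma expectation_like_concave I a phi psi : expectation_like I ->
  L phi -> L psi -> 0 <= a <= 1 ->
  a * I phi + (1 - a) * I psi <= I (fun s => a * phi s + (1 - a) * psi s).
Proof.
move=> [[Ia Iz] _] Lp Lq /andP[a0 a1].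
have b0 : 0 <= 1 - a by rewrite subr_ge0.
by rewrite -!Iz//; apply: Ia; exact: simple_funZ.
Qed.

Definition lower_env (C : set (set S -> R)) (phi : S -> R) : R :=
  inf [set sint p phi | p in C].

(** * Lower envelopes of sets of probabilities *)

Section LowerEnvelope.
Variable C : set (set S -> R).
Hypotheses (C0 : C !=set0) (CP : C `<=` fa_prob Sigma).

Lemma sint_bound p phi (M : R) : fa_prob Sigma p -> L phi ->
  (forall s, `|phi s| <= M) -> - M <= sint p phi.
Proof.
move=> pP Lp pM; rewrite -(sint_cst algS pP (- M)).
apply: (sint_le algS pP) => //; first exact: simple_fun_cst.
by move=> s; have := pM s; rewrite ler_norml => /andP[].
Qed.

Lemma lower_env_le p phi : L phi -> C p -> lower_env C phi <= sint p phi.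
Proof.
move=> Lp Cp; apply: ge_inf; last by exists p.
have [M _ pM] := simple_fun_bounded Lp.
by exists (- M) => _ [q Cq <-]; apply: sint_bound => //; exact: CP.
Qed.

Lemma lower_env_ge x phi : (forall p, C p -> x <= sint p phi) ->
  x <= lower_env C phi.
Proof.
move=> xC; apply: lb_le_inf; first by case: C0 => p Cp; exists (sint p phi), p.
by move=> _ [p Cp <-]; exact: xC.
Qed.

Lemma expectation_like_lower_env : expectation_like (lower_env C).
Proof.
split; [split|split].
- move=> phi psi Lp Lq; apply: lower_env_ge => p Cp.
  by rewrite (sintD algS (CP Cp))//; apply: lerD; exact: lower_env_le.
- move=> a phi; rewrite le_eqVlt => /predU1P[<- Lp|a0 Lp].
    rewrite mul0r; under eq_fun do rewrite mul0r.
    apply/eqP; rewrite eq_le; apply/andP; split; last first.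
      by apply: lower_env_ge => p Cp; rewrite (sint_cst algS (CP Cp)).
    case: C0 => p Cp; rewrite -[leRHS](sint_cst algS (CP Cp)).
    by apply: lower_env_le => //; exact: simple_fun_cst.
  apply/eqP; rewrite eq_le; apply/andP; split; last first.
    apply: lower_env_ge => p Cp; rewrite (sintZ algS (CP Cp))//.
    by rewrite ler_pM2l//; exact: lower_env_le.
  rewrite -ler_pdivrMl//; apply: lower_env_ge => p Cp.
  rewrite ler_pdivrMl// -(sintZ algS (CP Cp))//.
  by apply: lower_env_le => //; exact: simple_funZ.
- move=> phi psi Lp Lq le; apply: lower_env_ge => p Cp.
  apply: le_trans (lower_env_le Lp Cp) _.
  exact: (sint_le algS (CP Cp)).
- move=> c; apply/eqP; rewrite eq_le; apply/andP; split; last first.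
    by apply: lower_env_ge => p Cp; rewrite (sint_cst algS (CP Cp)).
  case: C0 => p Cp; rewrite -[leRHS](sint_cst algS (CP Cp)).
  by apply: lower_env_le => //; exact: simple_fun_cst.
Qed.

Lemma minE_lower_env (V : lmodType R) (u : V -> R) (f : S -> V) :
  simple_fun Sigma f -> minE u C f = lower_env C (u \o f).
Proof.
move=> sf; rewrite /minE /lower_env; congr inf.
apply/seteqP; split => _ [p Cp <-]; exists p => //.
  by rewrite (integE algS (CP Cp)).
by rewrite (integE algS (CP Cp)).
Qed.

Lemma maxE_lower_env (V : lmodType R) (u : V -> R) (f : S -> V) :
  simple_fun Sigma f -> maxE u C f = - lower_env C (fun s => - u (f s)).
Proof.
move=> sf; rewrite /maxE /lower_env /inf opprK; congr sup.
have Lu : L (u \o f) by exact: simple_fun_comp.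
apply/seteqP; split => [_ [p Cp <-]|_ [_ [p Cp <-] <-]].
  exists (sint p (fun s => - u (f s))); first by exists p.
  by rewrite (sintN algS (CP Cp) Lu) opprK (integE algS (CP Cp)).
by exists p => //; rewrite (sintN algS (CP Cp) Lu) opprK (integE algS (CP Cp)).
Qed.

End LowerEnvelope.

(* The separating function is read off the point of C nearest to p in finitely
   many coordinates that tell p from C. *)
Lemma lower_env_separation (C : set (set S -> R)) (p : set S -> R) :
  C !=set0 -> good_prob_set Sigma C -> fa_prob Sigma p -> ~ C p ->
  exists2 phi, L phi & sint p phi < lower_env C phi.
Proof.
move=> C0 [CP [Cconv Ccomp]] pP nCp.
have [r sep] := compact_finite_separation Ccomp nCp.
pose dist (q : set S -> R) : R := \sum_(A <- r) (q A - p A) ^+ 2.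
pose M := {ptws set S -> (R : topologicalType)}.
have cdist : continuous (dist : M -> R).
  apply: (@continuous_sum R M) => A q.
  apply: (@continuous_comp M _ _ (fun q : M => q A) (fun x : R => (x - p A) ^+ 2)).
    exact: continuous_eval.
  apply: (@cvg_comp _ _ _ (fun x : R => x - p A) (fun x : R => x ^+ 2)).
    by apply: cvgB; [exact: cvg_id|exact: cvg_cst].
  exact: exprn_continuous.
have [q0 /set_mem Cq0 minq0] := 
  @compact_EVT_min {ptws set S -> (R : topologicalType)} R dist C C0 Ccomp
    (continuous_subspaceT cdist).
pose a A := q0 A - p A.
(* The separating function is a combination of indicators, hence simple only if its sets lie in
   [Sigma]. The other coordinates have coefficient 0, as both probabilities vanish there by
   convention. *)
have Sr A : a A != 0 -> Sigma A.
  move=> aA; apply: contrapT => nS.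
  have [_ [_ [_ q00]]] := CP _ Cq0; have [_ [_ [_ p00]]] := pP.
  by move: aA; rewrite /a q00// p00// subrr eqxx.
have d0 : 0 < dist q0.
  have [A Ar qpA] := sep _ Cq0.
  rewrite /dist (big_rem _ Ar) /=; apply: ltr_pwDl.
    by rewrite exprn_even_gt0//= subr_eq0.
  by apply: sumr_ge0 => B _; exact: sqr_ge0.
pose phi s : R := \sum_(A <- r) a A * \1_A s.
have Lt A : L (fun s => a A * \1_A s).
  have [->|aA] := eqVneq (a A) 0.
    by under eq_fun do rewrite mul0r; exact: simple_fun_cst.
  by apply: simple_funZ; apply: simple_fun_indic => //; exact: Sr.
have Lphi : L phi by exact: simple_fun_sum.
have sphi q : fa_prob Sigma q -> sint q phi = \sum_(A <- r) a A * q A.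
  move=> qP; rewrite /phi; elim: (r) => [|A r' IH].
    by under eq_fun do rewrite big_nil; rewrite big_nil (sint_cst algS qP).
  under eq_fun do rewrite big_cons; rewrite big_cons.
  rewrite (sintD algS qP) ?IH//; last exact: simple_fun_sum.
  congr (_ + _); have [->|aA] := eqVneq (a A) 0.
    by under eq_fun do rewrite mul0r; rewrite (sint_cst algS qP) mul0r.
  have SA := Sr _ aA.
  by rewrite (sintZ algS qP) ?(sint_indic algS qP)//; exact: simple_fun_indic.
exists phi => //; apply: lt_le_trans (_ : sint p phi + dist q0 <= _).
  by rewrite ltrDl.
apply: lower_env_ge => // q Cq; rewrite !sphi//; last exact: CP.
pose b A := q A - q0 A.
have ab0 : 0 <= \sum_(A <- r) a A * b A.
  pose B := \sum_(A <- r) b A ^+ 2.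
  have B0 : 0 <= B by apply: sumr_ge0 => A _; exact: sqr_ge0.
  (* First-order condition at the nearest point: moving from [q0] towards [q] by [t] changes the
     squared distance by [t] times this expression. *)
  have key t : 0 < t <= 1 -> 0 <= 2 * (\sum_(A <- r) a A * b A) + t * B.
    move=> /andP[t0 t1].
    have Ct : C (fun A => t * q A + (1 - t) * q0 A) by apply: Cconv => //; rewrite ltW.
    have := minq0 _ (mem_set Ct); rewrite -subr_ge0.
    have -> : dist (fun A => t * q A + (1 - t) * q0 A) - dist q0 =
              t * (2 * (\sum_(A <- r) a A * b A) + t * B).
      rewrite /dist /B !mulr_sumr -big_split /= mulr_sumr -sumrB.
      by apply: eq_bigr => A _; rewrite /a /b; ring.
    by rewrite pmulr_rge0.
  rewrite leNgt; apply/negP => s0.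
  set s := \sum_(A <- r) a A * b A in s0 key.
  (* [B] may vanish, hence the denominator [B - s]. This weight keeps [t * B] at most [- s], so the
     expression in [key] would be at most [s < 0]. *)
  have t1 : 0 < - s / (B - s) <= 1.
    by rewrite divr_gt0 ?oppr_gt0 ?ler_pdivrMr; lra.
  have := key _ t1.
  have sB : - s / (B - s) * B <= - s.
    rewrite mulrAC ler_pdivrMr; last lra.
    nra.
  lra.
rewrite -subr_ge0 /dist opprD addrA -!sumrB.
apply: le_trans ab0 _; rewrite le_eqVlt; apply/orP; left; apply/eqP.
by apply: eq_bigr => A _; rewrite /a /b; ring.
Qed.

Lemma lower_env_le_subset (C D : set (set S -> R)) :
  C !=set0 -> D !=set0 -> good_prob_set Sigma C -> good_prob_set Sigma D ->
  ((forall phi, L phi -> lower_env C phi <= lower_env D phi) <-> D `<=` C).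
Proof.
move=> C0 D0 gC gD; have [CP _] := gC; have [DP _] := gD; split.
  move=> le p Dp; apply: contrapT => nCp.
  have [phi Lphi] := lower_env_separation C0 gC (DP _ Dp) nCp.
  by rewrite ltNge (le_trans (le _ Lphi))//; exact: lower_env_le.
by move=> DC phi Lphi; apply: lower_env_ge => // p /DC; exact: lower_env_le.
Qed.

End Superlinear.

(** * Probabilities dominating a superlinear functional *)

Section HahnBanach.
Variables (R : realType) (S : Type) (Sigma : set (set S)).
Hypothesis algS : is_algebra Sigma.
Notation L := (@simple_fun S Sigma R).
Notation superlinear := (@superlinear R S Sigma).
Notation expectation_like := (@expectation_like R S Sigma).

Let LD := @simple_funD R S Sigma algS.
Let LZ := @simple_funZ R S Sigma algS.
Let LN := @simple_funN R S Sigma algS.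

(** For superlinear [I] the expression increases with [t], and for [t = 1 / h] it is the difference
    quotient of [I] at [phi0] with step [h]: the tilt is the one-sided directional derivative of [I]
    at [phi0] in the direction [psi]. *)
Definition tilt (I : (S -> R) -> R) (phi0 psi : S -> R) : R :=
  sup [set I (fun s => psi s + t * phi0 s) - t * I phi0 | t in [set t | 0 <= t]].

Section Tilt.
Variables (I : (S -> R) -> R) (phi0 : S -> R).
Hypotheses (sI : superlinear I) (L0 : L phi0).

Lemma le_tilt t psi : L psi -> 0 <= t ->
  I (fun s => psi s + t * phi0 s) - t * I phi0 <= tilt I phi0 psi.
Proof.
move=> Lp t0; apply: ub_le_sup; last by exists t.
(* The supremum is finite: adding [- psi] to [psi + a * phi0] leaves [a * phi0], and superadditivity
   bounds every term by [- I (- psi)]. *)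
exists (- I (fun s => - psi s)) => _ [a /= a0 <-]; case: sI => Ia Iz.
have := Ia _ _ (LD Lp (LZ a L0)) (LN Lp).
under [in leRHS]eq_fun do rewrite addrAC subrr add0r.
by rewrite Iz//; lra.
Qed.

Lemma tilt_le x psi :
  (forall t, 0 <= t -> I (fun s => psi s + t * phi0 s) - t * I phi0 <= x) ->
  tilt I phi0 psi <= x.
Proof.
move=> h; apply: ge_sup; first by eexists; exists 0 => //=.
by move=> _ [t /= t0 <-]; exact: h.
Qed.

Lemma tilt_ge psi : L psi -> I psi <= tilt I phi0 psi.
Proof.
move=> Lp; have := le_tilt Lp (lexx 0).
by under eq_fun do rewrite mul0r addr0; rewrite mul0r subr0.
Qed.

(** Parameters [t] for [phi] and [t'] for [psi] combine to [t + t'] for the sum; scaling by [a > 0]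
    reparametrizes [t] as [t / a]. *)
Lemma superlinear_tilt : superlinear (tilt I phi0).
Proof.
have [Ia Iz] := sI; split => [phi psi Lp Lq|a phi].
  rewrite -lerBrDr; apply: tilt_le => t t0; rewrite lerBrDr -lerBrDl.
  apply: tilt_le => t' t'0; rewrite lerBrDl.
  apply: le_trans (le_tilt (LD Lp Lq) (addr_ge0 t0 t'0)).
  have := Ia _ _ (LD Lp (LZ t L0)) (LD Lq (LZ t' L0)).
  have -> : (fun s => phi s + t * phi0 s + (psi s + t' * phi0 s)) =
            (fun s => phi s + psi s + (t + t') * phi0 s).
    by apply/funext => s; ring.
  lra.
rewrite le_eqVlt => /predU1P[<- Lp|a0 Lp].
  rewrite mul0r; under eq_fun do rewrite mul0r.
  apply/eqP; rewrite eq_le; apply/andP; split.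
    apply: tilt_le => t t0; under eq_fun do rewrite add0r.
    by rewrite Iz// subrr.
  by rewrite -{1}(superlinear0 algS sI); apply: tilt_ge; exact: simple_fun_cst.
apply/eqP; rewrite eq_le; apply/andP; split.
  apply: tilt_le => t t0.
  have -> : (fun s => a * phi s + t * phi0 s) =
            (fun s => a * (phi s + (t / a) * phi0 s)).
    by apply/funext => s; field; rewrite gt_eqF.
  rewrite (Iz _ _ (ltW a0)); last by apply: LD => //; exact: LZ.
  have ta : 0 <= t / a by rewrite divr_ge0// ltW.
  apply: le_trans (ler_wpM2l (ltW a0) (le_tilt Lp ta)).
  by rewrite mulrBr mulrA (mulrC a (t / a)) divfK ?gt_eqF.
rewrite -ler_pdivlMl//; apply: tilt_le => t t0; rewrite ler_pdivlMl//.
apply: le_trans (le_tilt (LZ a Lp) (mulr_ge0 (ltW a0) t0)).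
rewrite mulrBr mulrA -(Iz _ _ (ltW a0)); last by apply: LD => //; exact: LZ.
by under eq_fun do rewrite mulrDr mulrA.
Qed.

End Tilt.

(** Zorn's lemma with pointwise suprema of chains. These are finite because
    [K phi <= - K (- phi) <= - I (- phi)] for every superlinear [K] above [I], and superadditive
    because the larger of two members of the chain bounds both. *)
Lemma maximal_superlinear I : superlinear I ->
  exists K, [/\ superlinear K, forall phi, L phi -> I phi <= K phi &
    forall K', superlinear K' -> (forall phi, L phi -> K phi <= K' phi) ->
      forall phi, L phi -> K' phi <= K phi].
Proof.
move=> sI; pose T := {K : (S -> R) -> R |
  superlinear K /\ forall phi, L phi -> I phi <= K phi}.
(* Only values on simple functions are compared, so this is a preorder and not an order. *)
pose le (K K' : T) := `[< forall phi, L phi -> sval K phi <= sval K' phi >].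
have I0 : superlinear I /\ forall phi, L phi -> I phi <= I phi by [].
have [||A Atot|[K [sK IK]] maxK] := @ZL_preorder T (exist _ I I0) le.
- by move=> K; apply/asboolP.
- move=> K1 K2 K3 /asboolP h1 /asboolP h2; apply/asboolP => phi Lp.
  exact: le_trans (h1 _ Lp) (h2 _ Lp).
- have [[K0 AK0]|A0] := pselect (A !=set0); last first.
    by exists (exist _ I I0) => K AK; exfalso; apply: A0; exists K.
  pose m phi : R := sup [set sval K phi | K in A].
  have m_ge K phi : A K -> L phi -> sval K phi <= m phi.
    move=> AK Lp; apply: ub_le_sup; last by exists K.
    exists (- I (fun s => - phi s)) => _ [[K' [sK' IK']] AK' <-] /=.
    have := superlinearN algS sK' Lp; have := IK' _ (LN Lp); lra.
  have m_le x phi : (forall K, A K -> sval K phi <= x) -> m phi <= x.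
    move=> h; apply: ge_sup; first by exists (sval K0 phi), K0.
    by move=> _ [K AK <-]; exact: h.
  have sm : superlinear m /\ forall phi, L phi -> I phi <= m phi.
    split; last first.
      move=> phi Lp; apply: le_trans (m_ge K0 _ AK0 Lp).
      by case: (svalP K0) => _; exact.
    split=> [phi psi Lp Lq|a phi].
      rewrite -lerBrDr; apply: (m_le) => K AK; rewrite lerBrDr -lerBrDl.
      apply: (m_le) => K' AK'; rewrite lerBrDl.
      have [/asboolP KK'|/asboolP K'K] := Atot _ _ AK AK'.
        apply: le_trans (m_ge _ _ AK' (LD Lp Lq)).
        have [[+ _] _] := svalP K' => /(_ _ _ Lp Lq); apply: le_trans.
        by rewrite lerD2r; exact: KK'.
      apply: le_trans (m_ge _ _ AK (LD Lp Lq)).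
      have [[+ _] _] := svalP K => /(_ _ _ Lp Lq); apply: le_trans.
      by rewrite lerD2l; exact: K'K.
    rewrite le_eqVlt => /predU1P[<- Lp|a0 Lp].
      rewrite mul0r; under eq_fun do rewrite mul0r.
      have s0 (K : T) : sval K (fun=> 0) = 0.
        by case: (svalP K) => sK _; exact: (superlinear0 algS sK).
      apply/eqP; rewrite eq_le; apply/andP; split.
        by apply: (m_le) => K AK; rewrite s0.
      by rewrite -[leLHS](s0 K0); apply: (m_ge) => //; exact: simple_fun_cst.
    apply/eqP; rewrite eq_le; apply/andP; split.
      apply: (m_le) => K AK; have [[_ Kz] _] := svalP K.
      by rewrite (Kz _ _ (ltW a0) Lp) ler_pM2l//; exact: m_ge.
    rewrite -ler_pdivlMl//; apply: (m_le) => K AK; rewrite ler_pdivlMl//.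
    have [[_ Kz] _] := svalP K; rewrite -(Kz _ _ (ltW a0) Lp).
    by apply: (m_ge) => //; exact: LZ.
  exists (exist _ m sm) => K AK; apply/asboolP => phi Lp; exact: m_ge.
exists K; split=> // K' sK' KK' phi Lp.
have IK' : superlinear K' /\ forall phi, L phi -> I phi <= K' phi.
  by split=> // psi Lq; exact: le_trans (IK _ Lq) (KK' _ Lq).
have /asboolP := maxK (exist _ K' IK') (asboolT KK').
exact.
Qed.

(* A maximal superlinear K is additive, because tilting it cannot enlarge it;
   tilting I towards phi0 beforehand forces K phi0 = I phi0. *)
Lemma linear_above_superlinear I phi0 : superlinear I -> L phi0 ->
  exists l, [/\ forall phi psi, L phi -> L psi ->
                  l (fun s => phi s + psi s) = l phi + l psi,
                forall a phi, L phi -> l (fun s => a * phi s) = a * l phi,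
                forall phi, L phi -> I phi <= l phi & l phi0 = I phi0].
Proof.
move=> sI L0; have [K [sK IK maxK]] := maximal_superlinear (superlinear_tilt sI L0).
have [Ka Kz] := sK.
have Kadd phi psi : L phi -> L psi -> K (fun s => phi s + psi s) = K phi + K psi.
  move=> Lp Lq; apply/eqP; rewrite eq_le Ka// andbT.
  have := maxK _ (superlinear_tilt sK Lq) (tilt_ge sK Lq) _ Lp.
  have := le_tilt sK Lq Lp ler01; rewrite mul1r.
  under eq_fun do rewrite mul1r.
  lra.
have KN phi : L phi -> K (fun s => - phi s) = - K phi.
  move=> Lp; apply/eqP; rewrite -addr_eq0 -Kadd//; last exact: LN.
  by under eq_fun do rewrite addNr; rewrite (superlinear0 algS sK).
exists K; split => // [a phi Lp|phi Lp|].
- have [a0|a0] := leP 0 a; first exact: Kz.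
  have -> : (fun s => a * phi s) = (fun s => - ((- a) * phi s)).
    by apply/funext => s; rewrite mulNr opprK.
  have na : 0 <= - a by rewrite oppr_ge0 ltW.
  by rewrite KN ?Kz ?mulNr ?opprK//; exact: LZ.
- exact: le_trans (tilt_ge sI L0 Lp) (IK _ Lp).
- apply/eqP; rewrite eq_le; apply/andP; split; last first.
    exact: le_trans (tilt_ge sI L0 L0) (IK _ L0).
  rewrite -lerN2 -KN//; apply: le_trans (IK _ (LN L0)).
  have := le_tilt sI L0 (LN L0) ler01.
  under eq_fun do rewrite mul1r addNr.
  by rewrite mul1r (superlinear0 algS sI) sub0r.
Qed.

(** Finitely additive Riesz representation: the measure is read off indicators, and a simple
    function is a finite combination of indicators of its fibres. The value 0 off [Sigma] follows
    the convention of [fa_prob]. *)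
Lemma prob_of_linear (l : (S -> R) -> R) :
  (forall phi psi, L phi -> L psi -> l (fun s => phi s + psi s) = l phi + l psi) ->
  (forall a phi, L phi -> l (fun s => a * phi s) = a * l phi) ->
  (forall phi, L phi -> (forall s, 0 <= phi s) -> 0 <= l phi) ->
  l (fun=> 1) = 1 ->
  exists2 p, fa_prob Sigma p & forall phi, L phi -> sint p phi = l phi.
Proof.
move=> lD lZ l0 l1; pose p (A : set S) : R := if `[< Sigma A >] then l (\1_A) else 0.
have pE A : Sigma A -> p A = l (\1_A) by move=> SA; rewrite /p asboolT.
have pP : fa_prob Sigma p.
  split; first by move=> A SA; rewrite pE//; apply: l0 => //; exact: simple_fun_indic.
  split.
    rewrite pE; last by case: algS.
    rewrite -[RHS]l1; congr l; apply/funext => s.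
    by rewrite indicE mem_set.
  split; last by move=> A nA; rewrite /p asboolF.
  move=> A B SA SB AB; have SU : Sigma (A `|` B) by case: algS => _ [_]; exact.
  rewrite !pE// -lD; [|exact: simple_fun_indic|exact: simple_fun_indic].
  congr l; apply/funext => s; rewrite !indicE in_setU.
  case: (boolP (s \in A)) => /= sA; last by rewrite add0r.
  rewrite memNset ?addr0// => sB.
  have : (A `&` B) s by split=> //; exact: set_mem.
  by rewrite AB.
exists p => // phi Lphi; have [r ur rr] := simple_fun_seq Lphi.
have -> : phi = fun s => \sum_(x <- r) x * \1_(phi @^-1` [set x]) s.
  by apply/funext => s; apply: simple_fun_decomp => //; rewrite rr.
have Lx x : L (\1_(phi @^-1` [set x]) : S -> R).
  by apply: simple_fun_indic => //; case: Lphi.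
elim: r {ur rr} => [|x r IH].
  under eq_fun do rewrite big_nil; rewrite (sint_cst algS pP).
  have := lZ 0 _ (simple_fun_cst algS 0).
  by under eq_fun do rewrite mul0r; rewrite mul0r.
under eq_fun do rewrite big_cons.
have Lr : L (fun s => \sum_(x <- r) x * \1_(phi @^-1` [set x]) s).
  by apply: simple_fun_sum => // y; exact: LZ.
rewrite (sintD algS pP)//; last exact: LZ.
rewrite lD//; last exact: LZ.
rewrite IH; congr (_ + _); rewrite (sintZ algS pP)// lZ// (sint_indic algS pP)//.
  by rewrite pE//; case: Lphi.
by case: Lphi.
Qed.

Definition core (I : (S -> R) -> R) : set (set S -> R) :=
  [set p | fa_prob Sigma p /\ forall phi, L phi -> I phi <= sint p phi].

(** A linear functional above [I] that touches it at [phi0] is automatically a probability: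
    positivity comes from monotonicity of [I], and mass 1 from the values of [I] at 1 and -1. *)
Lemma core_attained I phi0 : expectation_like I -> L phi0 ->
  exists2 p, core I p & sint p phi0 = I phi0.
Proof.
move=> [sI [Im Ic]] L0.
have [l [lD lZ Il l0]] := linear_above_superlinear sI L0.
have l1 : l (fun=> 1) = 1.
  have L1 c : L (fun=> c) by exact: simple_fun_cst.
  apply/eqP; rewrite eq_le; apply/andP; split; last first.
    by rewrite -{1}(Ic 1); exact: Il.
  have := Il _ (L1 (-1)); rewrite Ic.
  have -> : l (fun=> -1) = - l (fun=> 1).
    by rewrite -[RHS]mulN1r -lZ//; congr l; apply/funext => s; rewrite mulr1.
  by rewrite lerN2.
have [phi Lp p0|p pP pl] := prob_of_linear lD lZ _ l1.
  apply: le_trans (Il _ Lp); rewrite -(Ic 0); apply: Im => //.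
  exact: simple_fun_cst.
exists p; last by rewrite pl.
by split=> // phi Lp; rewrite pl//; exact: Il.
Qed.

Lemma good_core I : good_prob_set Sigma (core I).
Proof.
split; first by move=> p [].
split.
  move=> p q a [pP Ip] [qP Iq] /andP[a0 a1].
  have b0 : 0 <= 1 - a by rewrite subr_ge0.
  have mE phi : L phi -> sint (fun A => a * p A + (1 - a) * q A) phi =
      a * sint p phi + (1 - a) * sint q phi.
    move=> [fphi _]; rewrite /sint /fint !mulr_fsumr -fsbig_split//.
    by apply: eq_fsbigr => x _ /=; ring.
  split.
    have [p0 [p1 [pU pN]]] := pP; have [q0 [q1 [qU qN]]] := qP; split.
      by move=> A SA; rewrite addr_ge0// mulr_ge0// ?p0 ?q0.
    split; first by rewrite p1 q1; ring.
    split; first by move=> A B SA SB AB; rewrite pU// qU//; ring.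
    by move=> A nA; rewrite pN// qN//; ring.
  move=> phi Lp; rewrite mE//.
  have := ler_wpM2l a0 (Ip _ Lp); have := ler_wpM2l b0 (Iq _ Lp); lra.
rewrite /wcompact.
(* As in the Banach-Alaoglu theorem, the core is a closed subset of a Tychonoff cube. Sets outside
   [Sigma] cause no trouble, their value being 0. *)
apply: (subclosed_compact _ (@compact_unit_cube R S)) => [|p [pP _] A]; last first.
  have [p0 [p1 [pU pN]]] := pP; rewrite in_itv /=.
  have [SA|nA] := pselect (Sigma A); last by rewrite pN// lexx ler01.
  have SC : Sigma (~` A) by case: algS => _ [+ _]; exact.
  rewrite p0//= -p1 -(setUv A) pU// ?setICr// lerDl; exact: p0.
pose M := {ptws set S -> (R : topologicalType)}.
have -> : core I = fa_prob Sigma `&`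
    \bigcap_(phi in L) [set p : M | I phi <= sint p phi].
  by apply/seteqP; split => p [pP Ip]; split.
apply: closedI; first exact: closed_fa_prob.
apply: closed_bigI => phi [fphi _].
exact: (@closed_ge_fun R _ _ _ (continuous_sint fphi)).
Qed.

Lemma lower_env_core I phi : expectation_like I -> L phi ->
  lower_env (core I) phi = I phi.
Proof.
move=> eI Lp; have [p Ip pE] := core_attained eI Lp.
apply/eqP; rewrite eq_le; apply/andP; split.
  rewrite -pE; apply: (@lower_env_le _ _ _ algS) => //.
  by move=> q [].
by apply: lower_env_ge => [|q [_]]; [exists p|exact].
Qed.

End HahnBanach.

(** * Properties of twofold representations *)

Section SimpleFunctionExtrema.
Variables (R : realType) (S : Type) (Sigma : set (set S)).
Hypothesis algS : is_algebra Sigma.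
Notation L := (@simple_fun S Sigma R).

Lemma seq_max (x : R) (r : seq R) :
  exists2 y, y \in x :: r & forall z, z \in x :: r -> z <= y.
Proof.
elim: r => [|a r [y yr ymax]].
  by exists x; rewrite ?inE// => z; rewrite inE => /eqP ->.
have sub z : z \in [:: x, a & r] -> z = a \/ z \in x :: r.
  by rewrite !inE => /or3P[->|/eqP ->|->]; rewrite ?orbT; [right|left|right].
have [ay|ya] := leP a y.
  exists y; last by move=> z /sub[->|/ymax].
  by move: yr; rewrite !inE => /orP[->|->]; rewrite ?orbT.
exists a; first by rewrite !inE eqxx orbT.
by move=> z /sub[->//|/ymax zy]; exact: le_trans zy (ltW ya).
Qed.

Lemma simple_fun_argmax (phi : S -> R) (s0 : S) : L phi ->
  exists s1, forall s, phi s <= phi s1.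
Proof.
case=> /finite_seqP[r rr] _.
have [y yr ymax] := seq_max (phi s0) r.
have [s1 _ s1y] : range phi y.
  by move: yr; rewrite inE => /predU1P[->//|yr]; rewrite rr.
exists s1 => s; rewrite s1y; apply: ymax; rewrite inE; apply/orP; right.
by have : range phi (phi s) by []; rewrite rr.
Qed.

Lemma simple_fun_argmin (phi : S -> R) (s0 : S) : L phi ->
  exists s1, forall s, phi s1 <= phi s.
Proof.
move=> Lp; have [s1 h] := simple_fun_argmax s0 (simple_funN algS Lp).
by exists s1 => s; rewrite -lerN2.
Qed.

Lemma simple_fun_gt0 (phi : S -> R) : L phi -> (forall s, 0 < phi s) ->
  exists2 e, 0 < e & forall s, e <= phi s.
Proof.
move=> Lp p0; have [[s0 _]|noS] := pselect (exists s : S, True).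
  by have [s1 h] := simple_fun_argmin s0 Lp; exists (phi s1).
by exists 1 => // s; exfalso; apply: noS; exists s.
Qed.

Lemma expectation_like_inhabited (I : (S -> R) -> R) :
  expectation_like Sigma I -> exists s : S, True.
Proof.
move=> [_ [_ Ic]]; apply: contrapT => noS.
have /eqP : 1 = 0 :> R; last by rewrite oner_eq0.
rewrite -(Ic 1) -(Ic 0); congr I; apply/funext => s.
by exfalso; apply: noS; exists s.
Qed.

(** Monotonicity and translation make [I] 1-Lipschitz for the uniform norm; along mixtures this
    yields the openness in A2. *)
Lemma expectation_like_mix_lipschitz (I : (S -> R) -> R) phi psi :
  expectation_like Sigma I -> L phi -> L psi ->
  exists2 M, 0 < M & forall a b,
    I (fun s => a * phi s + (1 - a) * psi s) <=
    I (fun s => b * phi s + (1 - b) * psi s) + `|b - a| * M.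
Proof.
move=> eI Lp Lq.
have LM a : L (fun s => a * phi s + (1 - a) * psi s).
  by apply: (simple_funD algS); exact: (simple_funZ algS).
have [M M0 dM] := simple_fun_bounded (simple_funD algS Lp (simple_funN algS Lq)).
exists M => // a b; apply: (expectation_like_le_add algS) => // s.
rewrite -lerBlDl; apply: le_trans (ler_norm _) _.
have -> : a * phi s + (1 - a) * psi s - (b * phi s + (1 - b) * psi s) =
          - (b - a) * (phi s - psi s) by ring.
by rewrite normrM normrN ler_wpM2l.
Qed.

End SimpleFunctionExtrema.

(** * Preferences represented by a pair of functionals *)

Section DualRepresentation.
Variables (R : realType) (V : lmodType R) (S : Type).
Variables (Sigma : set (set S)) (X : set V).
Hypotheses (algS : is_algebra Sigma) (convX : convex_subset X).
Notation F := (simple_act Sigma X).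
Notation L := (@simple_fun S Sigma R).

Lemma simple_act_cst x : X x -> F (Defs.cst x).
Proof. by move=> Xx; split=> //; exact: (simple_fun_cst algS x). Qed.

Lemma simple_act_mix a f g : F f -> F g -> 0 <= a <= 1 -> F (mix a f g).
Proof.
move=> [Xf sf] [Xg sg] a01; split; first by move=> s; exact: convX.
exact: (simple_fun2 algS (fun x y : V => a *: x + (1 - a) *: y)).
Qed.

Lemma simple_act_comp (u : V -> R) f : F f -> L (fun s => u (f s)).
Proof. by move=> [_ sf]; exact: (simple_fun_comp algS u sf). Qed.

Lemma simple_act_of_fun (e : R -> V) (phi : S -> R) :
  L phi -> (forall s, X (e (phi s))) -> F (fun s => e (phi s)).
Proof. by move=> Lp Xe; split=> //; exact: (simple_fun_comp algS e Lp). Qed.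

Section Affine.
Variable u : V -> R.
Hypothesis uaff : affine_on X u.

Lemma affine_mix a f g : F f -> F g -> 0 <= a <= 1 ->
  (fun s => u (mix a f g s)) = (fun s => a * u (f s) + (1 - a) * u (g s)).
Proof. by move=> [Xf _] [Xg _] a01; apply/funext => s; exact: uaff. Qed.

Lemma affine_half x y : X x -> X y -> X (2^-1 *: x + 2^-1 *: y) /\
  u (2^-1 *: x + 2^-1 *: y) = 2^-1 * u x + 2^-1 * u y.
Proof.
move=> Xx Xy; have half01 : 0 <= (2^-1 : R) <= 1 by lra.
have hE : 1 - 2^-1 = 2^-1 :> R by field.
by have := uaff Xx Xy half01; have := convX Xx Xy half01; rewrite !hE.
Qed.

Lemma affine_ivt y z t : X y -> X z -> u y <= t <= u z ->
  exists2 x, X x & u x = t.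
Proof.
move=> Xy Xz /andP[yt tz].
have [uyz|uyz] := eqVneq (u y) (u z).
  by exists y => //; apply/eqP; rewrite eq_le yt uyz.
have d0 : 0 < u z - u y by rewrite subr_gt0 lt_neqAle uyz (le_trans yt).
pose a := (t - u y) / (u z - u y).
have a01 : 0 <= a <= 1.
  rewrite /a ler_pdivrMr// mul1r lerD2r tz andbT.
  by rewrite divr_ge0 ?subr_ge0 ?(ltW d0)// (le_trans yt).
exists (a *: z + (1 - a) *: y); first exact: convX.
by rewrite uaff// /a; field; rewrite gt_eqF.
Qed.

(** [e] is a section of [u], up to normalization, over the interval from -1 to 1; composing with it
    turns a small enough simple function into an act. *)
Lemma affine_segment : nonconstant_on X u ->
  exists (e : R -> V) (c d : R), 0 < d /\
    forall r, `|r| <= 1 -> X (e r) /\ u (e r) = c + d * r.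
Proof.
move=> [x [y [Xx [Xy uxy]]]].
wlog lt : x y Xx Xy uxy / u y < u x.
  move=> h; have [lt|lt|//] := ltgtP (u x) (u y); last exact: (h x y).
  by apply: (h y x) => // /esym.
exists (fun r => ((1 + r) / 2) *: x + (1 - (1 + r) / 2) *: y).
exists ((u x + u y) / 2), ((u x - u y) / 2).
split; first by rewrite divr_gt0// subr_gt0.
move=> r; rewrite ler_norml => /andP[r0 r1].
have a01 : 0 <= (1 + r) / 2 <= 1 by lra.
by split; [exact: convX|rewrite uaff//; field].
Qed.

End Affine.

(* K stands for the lower envelope of D: the maximum over D of phi is - K (- phi). *)
Definition dual_rep (pref : (S -> V) -> (S -> V) -> Prop) (u : V -> R)
    (I K : (S -> R) -> R) : Prop :=
  forall f g, F f -> F g ->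
    (pref f g <-> (I (fun s => u (g s)) < I (fun s => u (f s)) /\
                   K (fun s => - u (f s)) < K (fun s => - u (g s)))).

(** * Axioms satisfied by such a representation *)

Section Behaviour.
Variables (pref : (S -> V) -> (S -> V) -> Prop) (u : V -> R).
Variables (I K : (S -> R) -> R).
Hypotheses (uaff : affine_on X u) (unc : nonconstant_on X u).
Hypotheses (eI : expectation_like Sigma I) (eK : expectation_like Sigma K).
Hypothesis IK : forall phi, L phi -> I phi + K (fun s => - phi s) <= 0.
Hypothesis rep : dual_rep pref u I K.

Let Icst c : I (fun=> c) = c. Proof. by case: eI => _ []. Qed.
Let Kcst c : K (fun=> c) = c. Proof. by case: eK => _ []. Qed.

(** By [IK] the lower endpoint of [f] is at most its upper endpoint, so [k] below the lower one is
    also below the upper one and the second inequality is automatic. *)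
Lemma dual_rep_cstr f g k : F f -> F g -> (forall s, u (g s) = k) ->
  (pref f g <-> k < I (fun s => u (f s))).
Proof.
move=> Ff Fg gk; have := IK (simple_act_comp u Ff).
have uk : (fun s => u (g s)) = (fun=> k) by apply/funext.
have nk : (fun s => - u (g s)) = (fun=> - k) by apply/funext => s; rewrite gk.
rewrite rep// uk nk.
by rewrite Icst Kcst; split; [case|split=> //; lra].
Qed.

Lemma dual_rep_cstl f g k : F f -> F g -> (forall s, u (f s) = k) ->
  (pref f g <-> - k < K (fun s => - u (g s))).
Proof.
move=> Ff Fg fk; have := IK (simple_act_comp u Fg).
have uk : (fun s => u (f s)) = (fun=> k) by apply/funext.
have nk : (fun s => - u (f s)) = (fun=> - k) by apply/funext => s; rewrite fk.
rewrite rep// uk nk.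
by rewrite Icst Kcst; split; [case|split=> //; lra].
Qed.

Lemma dual_rep_cst x y : X x -> X y ->
  (pref (Defs.cst x) (Defs.cst y) <-> u y < u x).
Proof.
move=> Xx Xy; rewrite (@dual_rep_cstr _ _ (u y))//.
- by rewrite /Defs.cst Icst.
- exact: simple_act_cst.
- exact: simple_act_cst.
Qed.

Lemma dual_rep_gt_cst f x : F f -> X x ->
  (pref f (Defs.cst x) <-> u x < I (fun s => u (f s))).
Proof. by move=> Ff Xx; apply: dual_rep_cstr => //; exact: simple_act_cst. Qed.

Lemma dual_rep_lt_cst f x : F f -> X x ->
  (pref (Defs.cst x) f <-> - u x < K (fun s => - u (f s))).
Proof. by move=> Ff Xx; apply: dual_rep_cstl => //; exact: simple_act_cst. Qed.

Lemma dual_rep_indiff f x : F f -> X x ->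
  (indiff pref f (Defs.cst x) <->
   I (fun s => u (f s)) <= u x <= - K (fun s => - u (f s))).
Proof.
move=> Ff Xx; rewrite /indiff dual_rep_gt_cst// dual_rep_lt_cst//.
split=> [[/negP + /negP]|/andP[h1 h2]]; last by split; apply/negP; rewrite -leNgt; lra.
rewrite -!leNgt => h1 h2; apply/andP; split=> //; lra.
Qed.

(** Each endpoint lies between the least and the greatest value of [u] along [f], hence on a segment
    of [X]. This provides the constants with which A6 and uniqueness are tested. *)
Lemma dual_rep_attained f : F f ->
  (exists2 x, X x & u x = I (fun s => u (f s))) /\
  (exists2 x, X x & u x = - K (fun s => - u (f s))).
Proof.
move=> Ff; have [s0 _] := expectation_like_inhabited eI.
have Lf := simple_act_comp u Ff; have LNf := simple_funN algS Lf.
have [sM hM] := simple_fun_argmax s0 Lf.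
have [sm hm] := simple_fun_argmin algS s0 Lf.
have [Xf _] := Ff; have [_ [Im _]] := eI; have [_ [Km _]] := eK.
split; apply: (affine_ivt uaff (Xf sm) (Xf sM)); apply/andP; split.
- by rewrite -[leLHS]Icst; apply: Im => //; exact: simple_fun_cst.
- by rewrite -[leRHS]Icst; apply: Im => //; exact: simple_fun_cst.
- rewrite lerNr -[leRHS]Kcst; apply: Km => //; first exact: simple_fun_cst.
  by move=> s; rewrite lerN2.
- rewrite lerNl -[leLHS]Kcst; apply: Km => //; first exact: simple_fun_cst.
  by move=> s; rewrite lerN2.
Qed.

Lemma dual_rep_A1 : A1 Sigma X pref.
Proof.
split; [|split; [|split]].
- move=> f g Ff Fg /(rep Ff Fg)[h1 _] /(rep Fg Ff)[h2 _].
  by have := lt_trans h1 h2; rewrite ltxx.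
- move=> f g h Ff Fg Fh /(rep Ff Fg)[h1 h2] /(rep Fg Fh)[h3 h4].
  by apply/(rep Ff Fh); split; [exact: lt_trans h3 h1|exact: lt_trans h2 h4].
- have [x [y [Xx [Xy /eqP]]]] := unc; rewrite neq_lt => /orP[lt|lt].
    by exists y, x; split=> //; split=> //; apply/dual_rep_cst.
  by exists x, y; split=> //; split=> //; apply/dual_rep_cst.
- move=> x y z Xx Xy Xz.
  rewrite !dual_rep_cst// => /negP; rewrite -leNgt => xy /negP.
  by rewrite -leNgt => yz; apply/negP; rewrite -leNgt; exact: le_trans yz.
Qed.

Lemma dual_rep_A2 : A2 Sigma X pref.
Proof.
move=> f g h Ff Fg Fh.
have Lf := simple_act_comp u Ff; have Lg := simple_act_comp u Fg.
have mixN a : 0 <= a <= 1 -> (fun s => - u (mix a f g s)) =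
    (fun s => a * (- u (f s)) + (1 - a) * (- u (g s))).
  move=> a01; apply/funext => s.
  by have /(congr1 (fun k => k s)) /= -> := affine_mix uaff Ff Fg a01; ring.
have [M M0 lip] := expectation_like_mix_lipschitz algS eI Lf Lg.
have [N N0 lipK] := expectation_like_mix_lipschitz algS eK
  (simple_funN algS Lf) (simple_funN algS Lg).
have small (d d' : R) : 0 < d -> 0 < d' ->
    exists2 e, 0 < e & forall x, x < e -> x * M < d /\ x * N < d'.
  move=> d0 d'0; exists (Num.min (d / M) (d' / N)).
    by rewrite lt_min !divr_gt0.
  by move=> x; rewrite lt_min => /andP[]; rewrite !ltr_pdivlMr.
split=> a a01.
  rewrite (rep (simple_act_mix Ff Fg a01) Fh) => -[h1 h2].
  have d1 := h1; have d2 := h2; rewrite -subr_gt0 in d1; rewrite -subr_gt0 in d2.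
  have [e e0 eP] := small _ _ d1 d2.
  exists e; split=> // b b01 /eP[].
  rewrite (rep (simple_act_mix Ff Fg b01) Fh).
  rewrite !affine_mix// !mixN// => e1 e2; split.
    by have := lip a b; lra.
  by have := lipK b a; rewrite distrC; lra.
rewrite (rep Fh (simple_act_mix Ff Fg a01)) => -[h1 h2].
have d1 := h1; have d2 := h2; rewrite -subr_gt0 in d1; rewrite -subr_gt0 in d2.
have [e e0 eP] := small _ _ d1 d2.
exists e; split=> // b b01 /eP[].
rewrite (rep Fh (simple_act_mix Ff Fg b01)).
rewrite !affine_mix// !mixN// => e1 e2; split.
  by have := lip b a; rewrite distrC; lra.
by have := lipK a b; lra.
Qed.

Lemma dual_rep_A3 : A3 Sigma X pref.
Proof.
move=> f g x a Ff Fg Xx /andP[a0 a1].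
have a01 : 0 <= a <= 1 by rewrite !ltW.
have Fx := simple_act_cst Xx.
have IE h : F h -> I (fun s => u (mix a h (Defs.cst x) s)) =
    a * I (fun s => u (h s)) + (1 - a) * u x.
  move=> Fh; have Lh := simple_act_comp u Fh; rewrite affine_mix//.
  rewrite (expectation_like_translate algS ((1 - a) * u x) eI (simple_funZ algS a Lh)).
  by case: eI => -[_ ->]//; exact: ltW.
have KE h : F h -> K (fun s => - u (mix a h (Defs.cst x) s)) =
    a * K (fun s => - u (h s)) - (1 - a) * u x.
  move=> Fh; have Lh := simple_funN algS (simple_act_comp u Fh).
  have -> : (fun s => - u (mix a h (Defs.cst x) s)) =
      (fun s => a * (- u (h s)) + (- ((1 - a) * u x))).
    apply/funext => s.
    by have /(congr1 (fun k => k s)) /= -> := affine_mix uaff Fh Fx a01; ring.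
  rewrite (expectation_like_translate algS _ eK (simple_funZ algS a Lh)).
  by case: eK => -[_ ->]//; exact: ltW.
rewrite (rep Ff Fg) (rep (simple_act_mix Ff Fx a01) (simple_act_mix Fg Fx a01)).
by rewrite !IE// !KE// !ltrD2r !ltr_pM2l.
Qed.

Lemma dual_rep_A4 : A4 Sigma X pref.
Proof.
move=> x Xx; have Fx := simple_act_cst Xx.
have conv (a t y z : R) : 0 <= a <= 1 -> t < y -> t < z -> t < a * y + (1 - a) * z.
  move=> /andP[a0 a1] ty tz; have [->|an0] := eqVneq a 0; first lra.
  have : 0 < a * (y - t) by rewrite mulr_gt0 ?subr_gt0// lt_neqAle eq_sym an0.
  have : 0 <= (1 - a) * (z - t) by rewrite mulr_ge0 ?subr_ge0// ltW.
  nra.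
split=> f g a Ff Fg a01.
  have Fm := simple_act_mix Ff Fg a01.
  rewrite !(dual_rep_gt_cst _ Xx)// => h1 h2.
  rewrite affine_mix//; apply: lt_le_trans (conv _ _ _ _ a01 h1 h2) _.
  by apply: (expectation_like_concave algS) => //; exact: simple_act_comp.
have Fm := simple_act_mix Ff Fg a01.
rewrite !(dual_rep_lt_cst _ Xx)// => h1 h2.
have -> : (fun s => - u (mix a f g s)) =
    (fun s => a * (- u (f s)) + (1 - a) * (- u (g s))).
  apply/funext => s.
  by have /(congr1 (fun k => k s)) /= -> := affine_mix uaff Ff Fg a01; ring.
apply: lt_le_trans (conv _ _ _ _ a01 h1 h2) _.
by apply: (expectation_like_concave algS) => //; apply/simple_funN => //;
  exact: simple_act_comp.
Qed.

Lemma dual_rep_A5 : A5 Sigma X pref.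
Proof.
move=> f g Ff Fg fg.
have Lf := simple_act_comp u Ff; have Lg := simple_act_comp u Fg.
have [||e e0 eP] := @simple_fun_gt0 _ _ _ algS (fun s => u (f s) - u (g s)).
- exact: (simple_funD algS Lf (simple_funN algS Lg)).
- move=> s; rewrite subr_gt0; apply/dual_rep_cst; [by case: Ff|by case: Fg|].
  exact: fg.
apply/(rep Ff Fg); split.
  have := @expectation_like_le_add _ _ _ algS I (- e) _ _ eI Lg Lf.
  suff h s : u (g s) <= u (f s) + - e by move=> /(_ h); lra.
  by have := eP s; lra.
have := @expectation_like_le_add _ _ _ algS K (- e) _ _ eK
  (simple_funN algS Lf) (simple_funN algS Lg).
suff h s : - u (f s) <= - u (g s) + - e by move=> /(_ h); lra.
by have := eP s; lra.
Qed.

(** Testing the hypothesis at the two endpoints of the interval of [f] shows that it lies inside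
    that of [g], and nested intervals are never ranked. *)
Lemma dual_rep_A6 : A6 Sigma X pref.
Proof.
move=> f g Ff Fg h.
have [[x Xx xI] [y Xy yK]] := dual_rep_attained Ff.
have fIK := IK (simple_act_comp u Ff).
have /(dual_rep_indiff Fg Xx)/andP[h1 _] : indiff pref g (Defs.cst x).
  by apply: h => //; apply/(dual_rep_indiff Ff Xx); rewrite xI; lra.
have /(dual_rep_indiff Fg Xy)/andP[_ h2] : indiff pref g (Defs.cst y).
  by apply: h => //; apply/(dual_rep_indiff Ff Xy); rewrite yK; lra.
split=> [/(rep Ff Fg)[_ h3]|/(rep Fg Ff)[h3 _]]; lra.
Qed.

Lemma dual_rep_A7 : A7 Sigma X pref.
Proof.
move=> f g x y Ff Fg Xx Xy /(dual_rep_indiff Ff Xx)/andP[_ h1].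
rewrite (dual_rep_lt_cst Fg Xx) => h2.
move=> /(dual_rep_indiff Fg Xy)/andP[h3 _].
rewrite (dual_rep_gt_cst Ff Xy) => h4.
by apply/(rep Ff Fg); split; lra.
Qed.

(** Since [- u g] is [u f] shifted by [- 2 * k], translation turns the condition [- k < K (- u g)]
    for the midpoint to beat [g] into [k < K (u f)]. *)
Lemma dual_rep_complementary f g : F f -> F g -> complementary pref f g ->
  exists2 k, (forall s, u (g s) = 2 * k - u (f s)) &
             (pref f (mix 2^-1 f g) <-> k < I (fun s => u (f s))) /\
             (pref (mix 2^-1 f g) g <-> k < K (fun s => u (f s))).
Proof.
move=> Ff Fg fg; have [s0 _] := expectation_like_inhabited eI.
have half01 : 0 <= (2^-1 : R) <= 1 by lra.
have [Xf _] := Ff; have [Xg _] := Fg.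
have uh s : u (2^-1 *: f s + 2^-1 *: g s) = 2^-1 * u (f s) + 2^-1 * u (g s).
  by case: (affine_half uaff (Xf s) (Xg s)).
have Xh s : X (2^-1 *: f s + 2^-1 *: g s) by case: (affine_half uaff (Xf s) (Xg s)).
have gE s : u (g s) = 2 * ((u (f s0) + u (g s0)) / 2) - u (f s).
  have [] := fg s s0; rewrite !dual_rep_cst// !uh => /negP + /negP.
  by rewrite -!leNgt; lra.
have Fm := simple_act_mix Ff Fg half01.
have um s : u (mix 2^-1 f g s) = (u (f s0) + u (g s0)) / 2.
  by rewrite /mix uaff// gE; field.
exists ((u (f s0) + u (g s0)) / 2) => //; split.
  exact: (dual_rep_cstr Ff Fm um).
rewrite (dual_rep_cstl Fm Fg um).
have -> : (fun s => - u (g s)) =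
    (fun s => u (f s) + - (2 * ((u (f s0) + u (g s0)) / 2))).
  by apply/funext => s; rewrite gE; ring.
rewrite (expectation_like_translate algS _ eK (simple_act_comp u Ff)).
by split; lra.
Qed.

Lemma dual_rep_complementary_ex phi k : L phi ->
  exists f g c d, [/\ F f, F g, complementary pref f g, 0 < d &
    (forall s, u (f s) = c + d * phi s) /\ (forall s, u (g s) = 2 * (c + d * k) - u (f s))].
Proof.
move=> Lp; have [e [c [d [d0 eP]]]] := affine_segment uaff unc.
have [M M0 pM] := simple_fun_bounded Lp.
(* The scale must bring both [phi] and its reflection [2 * k - phi] into the interval from -1 to
   1. *)
pose N := M + 2 * `|k|.
have k0 : 0 <= `|k| by [].
have N0 : 0 < N by rewrite /N; lra.
have in1 s : `|phi s / N| <= 1 /\ `|(2 * k - phi s) / N| <= 1.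
  rewrite !normrM !normfV (gtr0_norm N0) !ler_pdivrMr// !mul1r.
  have := pM s; have := ler_normB (2 * k) (phi s).
  by rewrite normrM (@ger0_norm _ 2)// /N; split; lra.
exists (fun s => e (phi s / N)), (fun s => e ((2 * k - phi s) / N)), c, (d / N).
have fE s : u (e (phi s / N)) = c + d / N * phi s.
  by case: (in1 s) => /eP[_ ->] _; ring.
have gE s : u (e ((2 * k - phi s) / N)) = 2 * (c + d / N * k) - u (e (phi s / N)).
  by rewrite fE; case: (in1 s) => _ /eP[_ ->]; ring.
have Xf s : X (e (phi s / N)) by case: (in1 s) => /eP[].
have Xg s : X (e ((2 * k - phi s) / N)) by case: (in1 s) => _ /eP[].
split=> //.
- exact: (simple_act_of_fun (e := fun r => e (r / N))).
- exact: (simple_act_of_fun (e := fun r => e ((2 * k - r) / N))).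
- move=> s s'; have [X1 u1] := affine_half uaff (Xf s) (Xg s).
  have [X2 u2] := affine_half uaff (Xf s') (Xg s').
  by split; rewrite dual_rep_cst// u1 u2 !gE; lra.
- exact: divr_gt0.
Qed.

Lemma dual_rep_A8 : A8 Sigma X pref <-> forall phi, L phi -> I phi <= K phi.
Proof.
split=> [h phi Lp|le f g Ff Fg /(dual_rep_complementary Ff Fg)[k _ [-> ->]]].
  rewrite leNgt; apply/negP => lt.
  (* With the midpoint utility strictly between [K phi] and [I phi], after rescaling, [f] beats the
     midpoint but the midpoint does not beat [g]. *)
  have [f [g [c [d [Ff Fg fg d0 [fE gE]]]]]] :=
    dual_rep_complementary_ex ((I phi + K phi) / 2) Lp.
  have := h f g Ff Fg fg.
  have [k gk [-> ->]] := dual_rep_complementary Ff Fg fg.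
  have [s0 _] := expectation_like_inhabited eI.
  have -> : k = c + d * ((I phi + K phi) / 2).
    by have := gk s0; rewrite gE; lra.
  have fE' : (fun s => u (f s)) = (fun s => d * phi s + c).
    by apply/funext => s; rewrite fE addrC.
  rewrite fE' !(expectation_like_translate algS) ?eI ?eK//; try exact: simple_funZ.
  have [[_ Iz] _] := eI; have [[_ Kz] _] := eK.
  rewrite Iz ?Kz ?(ltW d0)//.
  have dlt : d * K phi < d * I phi by rewrite ltr_pM2l.
  have lt' : c + d * ((I phi + K phi) / 2) < d * I phi + c by lra.
  by move=> /(_ lt'); lra.
by move/lt_le_trans; apply; apply: le; exact: simple_act_comp.
Qed.

Lemma dual_rep_A9 : A9 Sigma X pref <-> forall phi, L phi -> K phi <= I phi.
Proof.
split=> [h phi Lp|le f g Ff Fg /(dual_rep_complementary Ff Fg)[k _ [-> ->]]].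
  rewrite leNgt; apply/negP => lt.
  have [f [g [c [d [Ff Fg fg d0 [fE gE]]]]]] :=
    dual_rep_complementary_ex ((I phi + K phi) / 2) Lp.
  have := h f g Ff Fg fg.
  have [k gk [-> ->]] := dual_rep_complementary Ff Fg fg.
  have [s0 _] := expectation_like_inhabited eI.
  have -> : k = c + d * ((I phi + K phi) / 2).
    by have := gk s0; rewrite gE; lra.
  have fE' : (fun s => u (f s)) = (fun s => d * phi s + c).
    by apply/funext => s; rewrite fE addrC.
  rewrite fE' !(expectation_like_translate algS) ?eI ?eK//; try exact: simple_funZ.
  have [[_ Iz] _] := eI; have [[_ Kz] _] := eK.
  rewrite Iz ?Kz ?(ltW d0)//.
  have dlt : d * I phi < d * K phi by rewrite ltr_pM2l.
  have lt' : c + d * ((I phi + K phi) / 2) < d * K phi + c by lra.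
  by move=> /(_ lt'); lra.
by move/lt_le_trans; apply; apply: le; exact: simple_act_comp.
Qed.

End Behaviour.

(** Integrating [phi] against a common point of [C] and [D] gives a value between the minimum over
    [C] and the maximum over [D]. *)
Lemma HP_rep_dual pref u C D : HP_rep Sigma X pref u C D ->
  [/\ expectation_like Sigma (lower_env C), expectation_like Sigma (lower_env D),
      forall phi, L phi -> lower_env C phi + lower_env D (fun s => - phi s) <= 0 &
      dual_rep pref u (lower_env C) (lower_env D)].
Proof.
move=> [uaff [unc [gC [gD [[p [Cp Dp]] rep]]]]].
have [CP _] := gC; have [DP _] := gD.
have C0 : C !=set0 by exists p.
have D0 : D !=set0 by exists p.
split; [exact: expectation_like_lower_env|exact: expectation_like_lower_env| |].
  move=> phi Lp; have := lower_env_le algS CP Lp Cp.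
  have := lower_env_le algS DP (simple_funN algS Lp) Dp.
  by rewrite (sintN algS (CP _ Cp))//; lra.
move=> f g Ff Fg; rewrite (rep f g Ff Fg).
have [_ sf] := Ff; have [_ sg] := Fg.
rewrite !(minE_lower_env algS CP)// !(maxE_lower_env algS DP)//.
by rewrite (ltrN2 (lower_env D _) (lower_env D _)).
Qed.

End DualRepresentation.

(** * Expected utility on a convex set *)

Section Mixtures.
Variables (R : realType) (V : lmodType R).

Definition mixv (a : R) (x y : V) : V := a *: x + (1 - a) *: y.

Lemma mixv0 x y : mixv 0 x y = y.
Proof. by rewrite /mixv scale0r add0r subr0 scale1r. Qed.

Lemma mixv1 x y : mixv 1 x y = x.
Proof. by rewrite /mixv subrr scale0r addr0 scale1r. Qed.

Lemma mixvv a x : mixv a x x = x.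
Proof. by rewrite /mixv -scalerDl addrC subrK scale1r. Qed.

Lemma mixvC a x y : mixv a x y = mixv (1 - a) y x.
Proof. by rewrite /mixv subKr addrC. Qed.

Lemma mixv_comb a s t x y :
  mixv a (mixv s x y) (mixv t x y) = mixv (a * s + (1 - a) * t) x y.
Proof.
rewrite /mixv !scalerDr !scalerA addrACA -!scalerDl.
by congr (_ *: _ + _ *: _); ring.
Qed.

Lemma mixv_swap a l x y m :
  mixv l (mixv a x y) m = mixv a (mixv l x m) (mixv l y m).
Proof.
rewrite /mixv !scalerDr !scalerA addrACA -scalerDl.
by congr (_ *: _ + _ *: _ + _ *: _); ring.
Qed.

End Mixtures.

Section ExpectedUtility.
Variables (R : realType) (V : lmodType R) (X : set V).
Hypothesis convX : convex_subset X.
Variable P : V -> V -> Prop.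
Hypothesis Pasym : forall x y, X x -> X y -> P x y -> ~ P y x.
Hypothesis Pntrans : forall x y z, X x -> X y -> X z ->
  ~ P x y -> ~ P y z -> ~ P x z.
Hypothesis Popen : forall x y z, X x -> X y -> X z ->
  open01 (fun a => P (mixv a x y) z) /\ open01 (fun a => P z (mixv a x y)).
Hypothesis Pindep : forall x y z a, X x -> X y -> X z -> 0 < a < 1 ->
  (P x y <-> P (mixv a x z) (mixv a y z)).
Variables (x1 x0 : V).
Hypotheses (Xx1 : X x1) (Xx0 : X x0) (P10 : P x1 x0).

Let sim x y := ~ P x y /\ ~ P y x.
Let e t := mixv t x1 x0.
Let m := e 2^-1.

Let Xmix a x y : X x -> X y -> 0 <= a <= 1 -> X (mixv a x y).
Proof. exact: convX. Qed.

Let Xe t : 0 <= t <= 1 -> X (e t). Proof. exact: Xmix. Qed.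

Let Xm : X m. Proof. by apply: Xe; lra. Qed.

Let sim_sym x y : sim x y -> sim y x. Proof. by case. Qed.

Let sim_trans x y z : X x -> X y -> X z -> sim x y -> sim y z -> sim x z.
Proof.
by move=> Xx Xy Xz [xy yx] [yz zy]; split; [exact: (Pntrans _ Xy)|exact: (Pntrans _ Xy)].
Qed.

Let P_siml x y z : X x -> X y -> X z -> sim x y -> (P x z <-> P y z).
Proof.
move=> Xx Xy Xz [xy yx]; split=> h; apply: contrapT => n.
  exact: (Pntrans Xx Xy Xz xy n).
exact: (Pntrans Xy Xx Xz yx n).
Qed.

Let P_simr x y z : X x -> X y -> X z -> sim x y -> (P z x <-> P z y).
Proof.
move=> Xx Xy Xz [xy yx]; split=> h; apply: contrapT => n.
  exact: (Pntrans Xz Xy Xx n yx).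
exact: (Pntrans Xz Xx Xy n xy).
Qed.

Let sim_indep x y z a : X x -> X y -> X z -> 0 <= a <= 1 -> sim x y ->
  sim (mixv a x z) (mixv a y z).
Proof.
move=> Xx Xy Xz /andP[a0 a1] [xy yx].
have [->|an0] := eqVneq a 0.
  by rewrite !mixv0; split=> zz; exact: (Pasym Xz Xz zz zz).
have [->|an1] := eqVneq a 1; first by rewrite !mixv1.
have a01 : 0 < a < 1 by rewrite !lt_neqAle a0 a1 an1 eq_sym an0.
split=> h; [apply: xy|apply: yx].
  exact: (Pindep Xx Xy Xz a01).2 h.
exact: (Pindep Xy Xx Xz a01).2 h.
Qed.

Let sim_mix x x' y y' a : X x -> X x' -> X y -> X y' -> 0 <= a <= 1 ->
  sim x x' -> sim y y' -> sim (mixv a x y) (mixv a x' y').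
Proof.
move=> Xx Xx' Xy Xy' a01 xx' yy'.
apply: (@sim_trans _ (mixv a x' y)); try exact: Xmix.
  exact: sim_indep.
rewrite !(mixvC a x'); apply: sim_indep => //; lra.
Qed.

Let e_gt s t : 0 <= s -> s < t -> t <= 1 -> P (e t) (e s).
Proof.
move=> s0 st t1.
have s1 : s < 1 by exact: lt_le_trans t1.
have P1s : P x1 (e s).
  have [->|sn0] := eqVneq s 0; first by rewrite /e mixv0.
  have a01 : 0 < 1 - s < 1 by rewrite subr_gt0 s1 gtrBl lt_neqAle eq_sym sn0.
  by have /(Pindep Xx1 Xx0 Xx1 a01) := P10; rewrite mixvv -mixvC.
have [->|tn1] := eqVneq t 1; first by rewrite /e mixv1.
have lt1 : t < 1 by rewrite lt_neqAle tn1.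
have d0 : 0 < 1 - s by rewrite subr_gt0.
(* [e t] is the mixture of [x1] and [e s] with this weight, so independence transfers the preference
   for [x1] over [e s] to [e t]. *)
have b01 : 0 < (t - s) / (1 - s) < 1.
  by rewrite divr_gt0 ?subr_gt0//= ltr_pdivrMr// mul1r ltrD2r.
have Xs : X (e s) by apply: Xe; rewrite s0 ltW.
have /(Pindep Xx1 Xs Xs b01) := P1s; rewrite mixvv.
rewrite -{1}(mixv1 x1 x0) /e mixv_comb.
rewrite (_ : _ * 1 + _ = t)//; field; exact/lt0r_neq0.
Qed.

Let e_lt_iff s t : 0 <= s <= 1 -> 0 <= t <= 1 -> (P (e t) (e s) <-> s < t).
Proof.
move=> s01 t01; split; last by move=> st; apply: e_gt => //; lra.
move=> Pts; rewrite ltNge; apply/negP; rewrite le_eqVlt => /predU1P[ts|ts].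
  by move: Pts; rewrite ts => h; exact: (Pasym (Xe s01) (Xe s01) h h).
apply: (Pasym (Xe t01) (Xe s01) Pts); apply: e_gt => //; lra.
Qed.

(** Take the supremum of the [t] with [z] preferred to [e t]: openness would push a strict
    preference for [z] beyond the supremum, and one for [e t] back onto members of the set. *)
Let solvable z : X z -> P x1 z -> P z x0 -> exists2 t, 0 <= t <= 1 & sim z (e t).
Proof.
move=> Xz P1z Pz0.
pose A := [set t | 0 <= t <= 1 /\ P z (e t)].
have A0 : A 0 by split; [lra|rewrite /e mixv0].
have Aub : ubound A 1 by move=> t [/andP[]].
have supA : has_sup A by split; [exists 0|exists 1].
have t01 : 0 <= sup A <= 1.
  apply/andP; split; first by apply: ub_le_sup => //; case: supA.
  by apply: ge_sup => //; exists 0.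
have [oL oR] := Popen Xx1 Xx0 Xz.
exists (sup A) => //; split=> h.
  have [d [d0 dP]] := oR _ t01 h.
  have t1 : sup A < 1.
    rewrite lt_neqAle; case/andP: t01 => _ ->; rewrite andbT; apply/eqP => t1.
    by move: h; rewrite t1 /e mixv1 => h; exact: (Pasym Xz Xx1 h).
  pose b := Num.min (sup A + d / 2) 1.
  have b1 : b <= 1 by rewrite ge_min lexx orbT.
  have bd : b <= sup A + d / 2 by rewrite ge_min lexx.
  have bA : sup A < b by rewrite lt_min t1 andbT; lra.
  have b01 : 0 <= b <= 1 by lra.
  have : A b by split=> //; apply: dP => //; rewrite gtr0_norm; lra.
  by move=> /(ub_le_sup (ex_intro _ _ Aub)); lra.
have [d [d0 dP]] := oL _ t01 h.
have [t [tt01 Pzt] td] := sup_adherent d0 supA.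
have tA : t <= sup A by apply: ub_le_sup; [exists 1|split].
have : P (e t) z by apply: dP => //; rewrite ler0_norm; lra.
exact: (Pasym Xz (Xe tt01) Pzt).
Qed.

(* r is the utility of x on the scale giving x0, m, x1 the utilities -1/2, 0, 1/2;
   mixing with m by a small weight l brings x between x0 and x1. *)
Let utility_at x r l :=
  [/\ 0 < l < 1, 0 <= 2^-1 + l * r <= 1 & sim (mixv l x m) (e (2^-1 + l * r))].

(** Mixing once more with [m], which sits at 1/2 on the scale, lowers the weight without changing
    [r]. Several points can thus be compared at a common weight. *)
Let utility_at_shrink x r l l' : X x -> 0 < l' <= l ->
  utility_at x r l -> utility_at x r l'.
Proof.
move=> Xx /andP[l'0 l'l] [l01 t01 ss].
have l0 : 0 < l by case/andP: l01.
pose k := l' / l.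
have k01 : 0 <= k <= 1 by rewrite /k ler_pdivrMr// mul1r l'l andbT divr_ge0 ?(ltW l'0) ?(ltW l0).
have l'E : l' = k * l by rewrite /k divfK// gt_eqF.
have tE : 2^-1 + l' * r = k * (2^-1 + l * r) + (1 - k) * 2^-1.
  by rewrite l'E; field.
split; first lra.
  rewrite tE; case/andP: k01 => k0 k1; case/andP: t01 => t0 t1.
  have := mulr_ge0 k0 t0; have : k * (2^-1 + l * r) <= k * 1 by rewrite ler_wpM2l.
  lra.
have -> : mixv l' x m = mixv k (mixv l x m) m.
  rewrite -[X in mixv k _ X](mixv0 x m) mixv_comb l'E.
  by congr mixv; ring.
rewrite tE /e -mixv_comb; apply: sim_indep => //; last exact: Xe.
apply: Xmix => //; lra.
Qed.

(** [m] lies strictly between [x0] and [x1], and by openness at weight 0 so do its slight mixtures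
    with [x], to which [solvable] applies. *)
Let utility_at_ex x : X x -> exists r l, utility_at x r l.
Proof.
move=> Xx.
have P1m : P x1 m by rewrite -(mixv1 x1 x0); apply: e_gt; lra.
have Pm0 : P m x0 by rewrite -(mixv0 x1 x0); apply: e_gt; lra.
have z01 : 0 <= (0 : R) <= 1 by lra.
have [_ /(_ 0 z01)] := Popen Xx Xm Xx1.
rewrite mixv0 => /(_ P1m)[d [d0 dP]].
have [/(_ 0 z01) + _] := Popen Xx Xm Xx0.
rewrite mixv0 => /(_ Pm0)[d' [d'0 d'P]].
pose l := Num.min 2^-1 (Num.min (d / 2) (d' / 2)).
have l0 : 0 < l by rewrite /l !lt_min; apply/and3P; split; lra.
have lh : l <= 2^-1 by rewrite ge_min lexx.
have ld : l <= d / 2 by rewrite !ge_min lexx orbT.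
have ld' : l <= d' / 2 by rewrite !ge_min lexx !orbT.
have l01 : 0 <= l <= 1 by lra.
have Pl1 : P x1 (mixv l x m) by apply: dP => //; rewrite subr0 gtr0_norm//; lra.
have Pl0 : P (mixv l x m) x0 by apply: d'P => //; rewrite subr0 gtr0_norm//; lra.
have [t t01 st] := solvable (Xmix Xx Xm l01) Pl1 Pl0.
have tE : 2^-1 + l * ((t - 2^-1) / l) = t by field; exact/lt0r_neq0.
by exists ((t - 2^-1) / l), l; split; rewrite ?tE//; lra.
Qed.

Lemma expected_utility :
  exists2 u, affine_on X u & forall x y, X x -> X y -> (P x y <-> u y < u x).
Proof.
(* Any admissible [r] may be chosen: affinity and order both follow from comparing positions on the
   strictly monotone scale [e] at a common weight. *)
pose u x := xget 0 [set r | exists l, utility_at x r l].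
have uP x : X x -> exists l, utility_at x (u x) l.
  by move=> Xx; have [r [l h]] := utility_at_ex Xx; 
  exact: (@xgetI _ 0 [set r | exists l, utility_at x r l] r (ex_intro _ l h)).
exists u.
  move=> x y a Xx Xy a01; have Xz := Xmix Xx Xy a01.
  have [lx hx] := uP _ Xx; have [ly hy] := uP _ Xy; have [lz hz] := uP _ Xz.
  pose l := Num.min lx (Num.min ly lz).
  have [lx0 _ _] := hx; have [ly0 _ _] := hy; have [lz0 _ _] := hz.
  have l0 : 0 < l by rewrite /l !lt_min; lra.
  have llx : 0 < l <= lx by rewrite l0 ge_min lexx.
  have lly : 0 < l <= ly by rewrite l0 !ge_min lexx orbT.
  have llz : 0 < l <= lz by rewrite l0 !ge_min lexx !orbT.
  have [l01 tx sx] := utility_at_shrink Xx llx hx.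
  have [_ ty sy] := utility_at_shrink Xy lly hy.
  have [_ tz sz] := utility_at_shrink Xz llz hz.
  have l01' : 0 <= l <= 1 by lra.
  set w := _ *: _ + _ *: _.
  rewrite -/(mixv a x y) in w *.
  have tE : a * (2^-1 + l * u x) + (1 - a) * (2^-1 + l * u y) =
            2^-1 + l * (a * u x + (1 - a) * u y) by field.
  have tm : 0 <= 2^-1 + l * (a * u x + (1 - a) * u y) <= 1.
    by rewrite -tE; nra.
  have sm : sim (mixv l w m) (e (2^-1 + l * (a * u x + (1 - a) * u y))).
    rewrite /w mixv_swap -tE /e -mixv_comb.
    by apply: sim_mix => //; try exact: Xmix; exact: Xe.
  have [n1 n2] : sim (e (2^-1 + l * u w)) (e (2^-1 + l * (a * u x + (1 - a) * u y))).
    apply: (@sim_trans _ (mixv l w m)); [exact: Xe|exact: Xmix|exact: Xe| |exact: sm].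
    exact: sim_sym.
  move: n1 n2; rewrite !e_lt_iff// => /negP + /negP; rewrite -!leNgt => h1 h2.
  have : l * u w = l * (a * u x + (1 - a) * u y) by lra.
  by apply: mulfI; exact/lt0r_neq0.
move=> x y Xx Xy.
have [lx hx] := uP _ Xx; have [ly hy] := uP _ Xy.
pose l := Num.min lx ly.
have [lx0 _ _] := hx; have [ly0 _ _] := hy.
have l0 : 0 < l by rewrite /l !lt_min; lra.
have llx : 0 < l <= lx by rewrite l0 ge_min lexx.
have lly : 0 < l <= ly by rewrite l0 !ge_min lexx orbT.
have [l01 tx sx] := utility_at_shrink Xx llx hx.
have [_ ty sy] := utility_at_shrink Xy lly hy.
have l01' : 0 <= l <= 1 by lra.
rewrite (Pindep Xx Xy Xm l01).
rewrite (P_siml (Xmix Xx Xm l01') (Xe tx) (Xmix Xy Xm l01') sx).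
rewrite (P_simr (Xmix Xy Xm l01') (Xe ty) (Xe tx) sy).
by rewrite e_lt_iff// ltrD2l ltr_pM2l.
Qed.

End ExpectedUtility.

(** * Extension of the preference to simple functions *)

Section ExtendedPreference.
Variables (R : realType) (V : lmodType R) (S : Type).
Variables (Sigma : set (set S)) (X : set V).
Hypotheses (algS : is_algebra Sigma) (convX : convex_subset X).
Notation F := (simple_act Sigma X).
Notation L := (@simple_fun S Sigma R).
Variable pref : (S -> V) -> (S -> V) -> Prop.
Hypotheses (a1 : A1 Sigma X pref) (a2 : A2 Sigma X pref) (a3 : A3 Sigma X pref).
Hypotheses (a4 : A4 Sigma X pref) (a5 : A5 Sigma X pref).
Variables (u : V -> R) (e : R -> V).
Hypotheses (uaff : affine_on X u)
  (uP : forall x y, X x -> X y -> (pref (Defs.cst x) (Defs.cst y) <-> u y < u x))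
  (eP : forall r, `|r| <= 1 -> X (e r) /\ u (e r) = r).

Let LD := @simple_funD R S Sigma algS.
Let LZ := @simple_funZ R S Sigma algS.
Let LN := @simple_funN R S Sigma algS.
Let Lc (c : R) : L (fun=> c) := simple_fun_cst algS c.
Let LDc := @simple_funDc R S Sigma algS.
Let Fmix := @simple_act_mix R V S Sigma X algS convX.
Let Fcst := @simple_act_cst R V S Sigma X algS.
Let Lact := @simple_act_comp R V S Sigma X algS u.

Let pref_asym f g : F f -> F g -> pref f g -> ~ pref g f.
Proof. by case: a1 => + _; exact. Qed.

Let pref_trans f g h : F f -> F g -> F h -> pref f g -> pref g h -> pref f h.
Proof. by case: a1 => _ [+ _]; exact. Qed.

Lemma extended_inhabited : exists s : S, True.
Proof.
apply: contrapT => noS; have [_ [_ [[x [y [Xx [Xy xy]]]] _]]] := a1.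
have E : Defs.cst x = Defs.cst y :> (S -> V).
  by apply/funext => s; exfalso; apply: noS; exists s.
by move: (xy); rewrite E => yy; apply: (pref_asym (Fcst Xy) (Fcst Xy) yy yy).
Qed.

Let umix a f g s : F f -> F g -> 0 <= a <= 1 ->
  u (mix a f g s) = a * u (f s) + (1 - a) * u (g s).
Proof. by move=> Ff Fg a01; have /(congr1 (fun k => k s)) := affine_mix uaff Ff Fg a01. Qed.

Let Xe0 : X (e 0). Proof. by have [] := @eP 0; rewrite ?normr0. Qed.
Let ue0 : u (e 0) = 0. Proof. by have [] := @eP 0; rewrite ?normr0. Qed.

Let shrink (a : R) (f : S -> V) : S -> V := mix a f (Defs.cst (e 0)).

Let Fshrink a f : F f -> 0 <= a <= 1 -> F (shrink a f).
Proof. by move=> Ff a01; apply: Fmix => //; exact: Fcst. Qed.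

Let ushrink a f s : F f -> 0 <= a <= 1 -> u (shrink a f s) = a * u (f s).
Proof. by move=> Ff a01; rewrite umix ?ue0 ?mulr0 ?addr0//; exact: Fcst. Qed.

Let pref_shrink a f g : F f -> F g -> 0 < a < 1 ->
  (pref f g <-> pref (shrink a f) (shrink a g)).
Proof. by move=> Ff Fg a01; exact: a3. Qed.

Let half01 : 0 < (2^-1 : R) < 1. Proof. by lra. Qed.
Let half01w : 0 <= (2^-1 : R) <= 1. Proof. by lra. Qed.

Let mix1 (f g : S -> V) : mix (1 : R) f g = f.
Proof. by apply/funext => s; rewrite /mix scale1r subrr scale0r addr0. Qed.

(** [f] may already take the worst values in [X]; halving towards utility 0 leaves room strictly
    below, either at the minimum of [f] or at utility -1. *)
Let below_half f : F f -> exists2 y, X y & forall s, u y < u (shrink 2^-1 f s).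
Proof.
move=> Ff; have [s0 _] := extended_inhabited; have [Xf _] := Ff.
have [s1 h] := simple_fun_argmin algS s0 (Lact Ff).
have [Xm um] : X (e (-1)) /\ u (e (-1)) = -1 by apply: eP; rewrite normrN1.
have [lt|lt] := leP (u (f s1)) (-1).
  exists (f s1) => // s; rewrite ushrink//; have := h s; lra.
by exists (e (-1)) => // s; rewrite ushrink// um; have := h s; lra.
Qed.

Let above_half f : F f -> exists2 y, X y & forall s, u (shrink 2^-1 f s) < u y.
Proof.
move=> Ff; have [s0 _] := extended_inhabited; have [Xf _] := Ff.
have [s1 h] := simple_fun_argmax s0 (Lact Ff).
have [Xm um] : X (e 1) /\ u (e 1) = 1 by apply: eP; rewrite normr1.
have [lt|lt] := leP 1 (u (f s1)).
  exists (f s1) => // s; rewrite ushrink//; have := h s; lra.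
by exists (e 1) => // s; rewrite ushrink// um; have := h s; lra.
Qed.

Let near1 (d : R) : 0 < d -> exists2 a, 0 < a < 1 & `|a - 1| < d.
Proof.
move=> d0; exists (Num.max 2^-1 (1 - d / 2)).
  by apply/andP; split; [rewrite lt_max|rewrite gt_max]; lra.
have : 1 - d / 2 <= Num.max 2^-1 (1 - d / 2) by rewrite le_max lexx orbT.
have : Num.max 2^-1 (1 - d / 2) <= 1 by rewrite ge_max; lra.
by move=> h1 h2; rewrite ler0_norm; lra.
Qed.

Let one01 : 0 <= (1 : R) <= 1. Proof. by lra. Qed.

(** A5 only covers strict dominance. So [f] is first worsened slightly, which A2 tolerates, and [f']
    strictly dominates the result; the halving makes such a worsening possible. *)
Lemma pref_mono_l f f' g : F f -> F f' -> F g -> (forall s, u (f s) <= u (f' s)) ->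
  pref f g -> pref f' g.
Proof.
move=> Ff Ff' Fg le /(pref_shrink Ff Fg half01) fg.
apply/(pref_shrink Ff' Fg half01).
have [y Xy yP] := below_half Ff.
have Fh := Fshrink Ff half01w; have Fh' := Fshrink Ff' half01w.
have Fg' := Fshrink Fg half01w.
have [/(_ _ one01) + _] := a2 Fh (Fcst Xy) Fg'; rewrite mix1 => /(_ fg)[d [d0 dP]].
have [a a01 ad] := near1 d0; have a01w : 0 <= a <= 1 by lra.
have Fa := Fmix Fh (Fcst Xy) a01w.
apply: (pref_trans Fh' Fa Fg'); last exact: dP.
apply: a5 => // s; apply/uP; [by case: Fh'|by case: Fa|].
rewrite umix//; last exact: Fcst.
have : u (shrink 2^-1 f s) <= u (shrink 2^-1 f' s).
  by rewrite !ushrink// ler_pM2l//; lra.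
have : 0 < (1 - a) * (u (shrink 2^-1 f s) - u y).
  by rewrite mulr_gt0 ?subr_gt0//; lra.
rewrite /Defs.cst; lra.
Qed.

Lemma pref_mono_r f g g' : F f -> F g -> F g' -> (forall s, u (g' s) <= u (g s)) ->
  pref f g -> pref f g'.
Proof.
move=> Ff Fg Fg' le /(pref_shrink Ff Fg half01) fg.
apply/(pref_shrink Ff Fg' half01).
have [y Xy yP] := above_half Fg.
have Fh := Fshrink Fg half01w; have Fh' := Fshrink Fg' half01w.
have Ff' := Fshrink Ff half01w.
have [_ /(_ _ one01)] := a2 Fh (Fcst Xy) Ff'; rewrite mix1 => /(_ fg)[d [d0 dP]].
have [a a01 ad] := near1 d0; have a01w : 0 <= a <= 1 by lra.
have Fa := Fmix Fh (Fcst Xy) a01w.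
apply: (pref_trans Ff' Fa Fh'); first exact: dP.
apply: a5 => // s; apply/uP; [by case: Fa|by case: Fh'|].
rewrite umix//; last exact: Fcst.
have : u (shrink 2^-1 g' s) <= u (shrink 2^-1 g s).
  by rewrite !ushrink// ler_pM2l//; lra.
have : 0 < (1 - a) * (u y - u (shrink 2^-1 g s)).
  by rewrite mulr_gt0 ?subr_gt0//; lra.
rewrite /Defs.cst; lra.
Qed.

Lemma pref_utility f f' g g' : F f -> F f' -> F g -> F g' ->
  (forall s, u (f s) = u (f' s)) -> (forall s, u (g s) = u (g' s)) ->
  (pref f g <-> pref f' g').
Proof.
move=> Ff Ff' Fg Fg' ff' gg'; split=> h.
  apply: (@pref_mono_l f) => //; first by move=> s; rewrite ff'.
  by apply: (@pref_mono_r f g) => // s; rewrite gg'.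
apply: (@pref_mono_l f') => //; first by move=> s; rewrite ff'.
by apply: (@pref_mono_r f' g') => // s; rewrite gg'.
Qed.

(* By A3 the preference is invariant under rescaling of the utility profiles,
   which frees the extension from the bounds of the range of u. *)
Definition ext_pref (phi psi : S -> R) : Prop :=
  exists l f g, [/\ 0 < l, F f, F g, pref f g &
    (forall s, u (f s) = l * phi s) /\ (forall s, u (g s) = l * psi s)].

Lemma ext_prefE l f g phi psi : 0 < l -> F f -> F g ->
  (forall s, u (f s) = l * phi s) -> (forall s, u (g s) = l * psi s) ->
  (ext_pref phi psi <-> pref f g).
Proof.
move=> l0 Ff Fg uf ug; split; last by move=> fg; exists l, f, g.
move=> [l' [f' [g' [l'0 Ff' Fg' fg' [uf' ug']]]]].
(* Shrinking [f] by [l' / (l + l')] and [f'] by [l / (l + l')] gives both the profile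
   [l * l' / (l + l') * phi]. These weights stay below 1, as A3 requires. *)
have s0 : 0 < l + l' by lra.
have b01 : 0 < l' / (l + l') < 1 by rewrite divr_gt0//= ltr_pdivrMr//; lra.
have b01' : 0 < l / (l + l') < 1 by rewrite divr_gt0//= ltr_pdivrMr//; lra.
apply/(pref_shrink Ff Fg b01).
apply/(@pref_utility _ (shrink (l / (l + l')) f') _ (shrink (l / (l + l')) g')).
- by apply: Fshrink => //; lra.
- by apply: Fshrink => //; lra.
- by apply: Fshrink => //; lra.
- by apply: Fshrink => //; lra.
- by move=> s; rewrite !ushrink ?uf ?uf'//; [ring|lra|lra].
- by move=> s; rewrite !ushrink ?ug ?ug'//; [ring|lra|lra].
exact: (pref_shrink Ff' Fg' b01').1 fg'.
Qed.

Lemma ext_pref_act f g : F f -> F g ->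
  (pref f g <-> ext_pref (fun s => u (f s)) (fun s => u (g s))).
Proof. by move=> Ff Fg; rewrite (@ext_prefE 1 f g) // => s; rewrite mul1r. Qed.

Lemma realize phi : L phi -> exists2 M, 0 < M & forall l, 0 < l <= M ->
  exists2 f, F f & forall s, u (f s) = l * phi s.
Proof.
move=> Lp; have [M M0 pM] := simple_fun_bounded Lp.
exists M^-1; first by rewrite invr_gt0.
move=> l /andP[l0 lM].
have in1 s : `|l * phi s| <= 1.
  rewrite normrM (gtr0_norm l0) -(mulVf (lt0r_neq0 M0)).
  by apply: ler_pM => //; exact: ltW.
exists (fun s => e (l * phi s)); last by move=> s; have [] := eP (in1 s).
apply: (simple_act_of_fun algS (e := fun r => e (l * r))) => // s.
by have [] := eP (in1 s).
Qed.

Lemma realize2 phi psi : L phi -> L psi -> exists l f g, [/\ 0 < l, F f, F g,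
  (forall s, u (f s) = l * phi s) & (forall s, u (g s) = l * psi s)].
Proof.
move=> /realize[M M0 MP] /realize[N N0 NP].
have l0 : 0 < Num.min M N by rewrite lt_min M0.
have [|f Ff uf] := MP (Num.min M N); first by rewrite l0 ge_min lexx.
have [|g Fg ug] := NP (Num.min M N); first by rewrite l0 ge_min lexx orbT.
by exists (Num.min M N), f, g.
Qed.

Lemma realize3 phi psi chi : L phi -> L psi -> L chi ->
  exists l f g h, [/\ 0 < l, F f /\ F g /\ F h, (forall s, u (f s) = l * phi s),
  (forall s, u (g s) = l * psi s) & (forall s, u (h s) = l * chi s)].
Proof.
move=> /realize[M M0 MP] /realize[N N0 NP] /realize[W W0 WP].
pose l := Num.min M (Num.min N W).
have l0 : 0 < l by rewrite !lt_min M0 N0.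
have [|f Ff uf] := MP l; first by rewrite l0 ge_min lexx.
have [|g Fg ug] := NP l; first by rewrite l0 !ge_min lexx orbT.
have [|h Fh uh] := WP l; first by rewrite l0 !ge_min lexx !orbT.
by exists l, f, g, h.
Qed.

Lemma ext_pref_asym phi psi : L phi -> L psi -> ext_pref phi psi -> ~ ext_pref psi phi.
Proof.
move=> Lp Lq; have [l [f [g [l0 Ff Fg uf ug]]]] := realize2 Lp Lq.
by rewrite (ext_prefE l0 Ff Fg uf ug) (ext_prefE l0 Fg Ff ug uf); exact: pref_asym.
Qed.

Lemma ext_pref_trans phi psi chi : L phi -> L psi -> L chi ->
  ext_pref phi psi -> ext_pref psi chi -> ext_pref phi chi.
Proof.
move=> Lp Lq Lr.
have [l [f [g [h [l0 [Ff [Fg Fh]] uf ug uh]]]]] := realize3 Lp Lq Lr.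
rewrite (ext_prefE l0 Ff Fg uf ug) (ext_prefE l0 Fg Fh ug uh).
by rewrite (ext_prefE l0 Ff Fh uf uh); exact: pref_trans.
Qed.

Lemma ext_pref_strict phi psi : L phi -> L psi -> (forall s, psi s < phi s) ->
  ext_pref phi psi.
Proof.
move=> Lp Lq lt; have [l [f [g [l0 Ff Fg uf ug]]]] := realize2 Lp Lq.
apply/(ext_prefE l0 Ff Fg uf ug); apply: a5 => // s.
by apply/uP; [case: Ff|case: Fg|rewrite uf ug ltr_pM2l].
Qed.

Lemma ext_pref_cst c d : ext_pref (fun=> c) (fun=> d) <-> d < c.
Proof.
split=> [cd|dc]; last exact: ext_pref_strict.
rewrite ltNge; apply/negP; rewrite le_eqVlt => /predU1P[E|lt].
  by move: cd; rewrite E => h; exact: (ext_pref_asym (Lc _) (Lc _) h h).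
by apply: (ext_pref_asym (Lc _) (Lc _) cd); exact: ext_pref_strict.
Qed.

Lemma ext_pref_mono_l phi phi' psi : L phi -> L phi' -> L psi ->
  (forall s, phi s <= phi' s) -> ext_pref phi psi -> ext_pref phi' psi.
Proof.
move=> Lp Lq Lr le.
have [l [f [g [h [l0 [Ff [Fg Fh]] uf ug uh]]]]] := realize3 Lp Lq Lr.
rewrite (ext_prefE l0 Ff Fh uf uh) (ext_prefE l0 Fg Fh ug uh).
by apply: pref_mono_l => // s; rewrite uf ug ler_pM2l.
Qed.

Lemma ext_pref_mono_r phi psi psi' : L phi -> L psi -> L psi' ->
  (forall s, psi' s <= psi s) -> ext_pref phi psi -> ext_pref phi psi'.
Proof.
move=> Lp Lq Lr le.
have [l [f [g [h [l0 [Ff [Fg Fh]] uf ug uh]]]]] := realize3 Lp Lq Lr.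
rewrite (ext_prefE l0 Ff Fg uf ug) (ext_prefE l0 Ff Fh uf uh).
by apply: pref_mono_r => // s; rewrite ug uh ler_pM2l.
Qed.

Lemma ext_pref_scale a phi psi : 0 < a -> L phi -> L psi ->
  (ext_pref (fun s => a * phi s) (fun s => a * psi s) <-> ext_pref phi psi).
Proof.
move=> a0 Lp Lq.
have [l [f [g [l0 Ff Fg uf ug]]]] := realize2 (LZ a Lp) (LZ a Lq).
rewrite (ext_prefE l0 Ff Fg uf ug).
by rewrite (@ext_prefE (l * a) f g) ?mulr_gt0// => s; rewrite ?uf ?ug mulrA.
Qed.

Lemma ext_pref_translate c phi psi : L phi -> L psi ->
  (ext_pref (fun s => phi s + c) (fun s => psi s + c) <-> ext_pref phi psi).
Proof.
move=> Lp Lq.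
have [l [f [g [h [l0 [Ff [Fg Fh]] uf ug uh]]]]] := realize3 Lp Lq (Lc c).
have [s0 _] := extended_inhabited; have Xh : X (h s0) by case: Fh.
(* Mixing half and half with a constant of utility [l * c] turns the profile [l * phi] into
   [l / 2 * (phi + c)], hence the new scale. *)
have l20 : 0 < l / 2 by rewrite divr_gt0.
have Fx := Fcst Xh.
rewrite (ext_prefE l0 Ff Fg uf ug) (a3 Ff Fg Xh half01).
by rewrite (ext_prefE l20 (Fmix Ff Fx half01w) (Fmix Fg Fx half01w))//;
  move=> s; rewrite umix// /Defs.cst uh ?uf ?ug; field.
Qed.

Lemma ext_pref_openr phi c : L phi -> ext_pref phi (fun=> c) ->
  exists2 d, 0 < d & ext_pref phi (fun=> c + d).
Proof.
move=> Lp.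
have [l [f [g [h [l0 [Ff [Fg Fh]] uf ug uh]]]]] := realize3 Lp (Lc c) (Lc (c + 1)).
rewrite (ext_prefE l0 Ff Fg uf ug) => fg.
have [_ /(_ _ one01)] := a2 Fg Fh Ff; rewrite mix1 => /(_ fg)[d [d0 dP]].
have [a a01 ad] := near1 d0; have a01w : 0 <= a <= 1 by lra.
exists (1 - a); first lra.
apply/(ext_prefE l0 Ff (Fmix Fg Fh a01w) uf); last exact: dP.
by move=> s; rewrite umix// ug uh; ring.
Qed.

Lemma ext_pref_openl phi c : L phi -> ext_pref (fun=> c) phi ->
  exists2 d, 0 < d & ext_pref (fun=> c - d) phi.
Proof.
move=> Lp.
have [l [f [g [h [l0 [Ff [Fg Fh]] uf ug uh]]]]] := realize3 Lp (Lc c) (Lc (c - 1)).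
rewrite (ext_prefE l0 Fg Ff ug uf) => gf.
have [/(_ _ one01) + _] := a2 Fg Fh Ff; rewrite mix1 => /(_ gf)[d [d0 dP]].
have [a a01 ad] := near1 d0; have a01w : 0 <= a <= 1 by lra.
exists (1 - a); first lra.
apply/(ext_prefE l0 (Fmix Fg Fh a01w) Ff _ uf); last exact: dP.
by move=> s; rewrite umix// ug uh; ring.
Qed.

Lemma ext_pref_convex a phi psi c : L phi -> L psi -> 0 <= a <= 1 ->
  ext_pref phi (fun=> c) -> ext_pref psi (fun=> c) ->
  ext_pref (fun s => a * phi s + (1 - a) * psi s) (fun=> c).
Proof.
move=> Lp Lq a01.
have [l [f [g [h [l0 [Ff [Fg Fh]] uf ug uh]]]]] := realize3 Lp Lq (Lc c).
have [s0 _] := extended_inhabited; have Xh : X (h s0) by case: Fh.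
have ux (s : S) : u (Defs.cst (h s0) s) = l * c by rewrite /Defs.cst uh.
rewrite (ext_prefE l0 Ff (Fcst Xh) uf ux) (ext_prefE l0 Fg (Fcst Xh) ug ux).
rewrite (ext_prefE l0 (Fmix Ff Fg a01) (Fcst Xh) _ ux).
  by have [+ _] := a4 Xh; exact.
by move=> s; rewrite umix// uf ug; ring.
Qed.

(** * Lower and upper endpoints of the incomparable constants *)

Definition ext_lower (phi : S -> R) : R := sup [set c | ext_pref phi (fun=> c)].
Definition ext_upper (phi : S -> R) : R := inf [set c | ext_pref (fun=> c) phi].

Lemma ext_bounds phi : L phi -> exists M,
  [/\ ext_pref phi (fun=> - M), ext_pref (fun=> M) phi,
      forall c, ext_pref phi (fun=> c) -> c <= M &
      forall c, ext_pref (fun=> c) phi -> - M <= c].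
Proof.
move=> Lp; have [M M0 pM] := simple_fun_bounded Lp.
have lt s : - (M + 1) < phi s < M + 1.
  by have := pM s; rewrite ler_norml => /andP[]; lra.
have h1 : ext_pref phi (fun=> - (M + 1)).
  by apply: ext_pref_strict => // s; case/andP: (lt s).
have h2 : ext_pref (fun=> M + 1) phi.
  by apply: ext_pref_strict => // s; case/andP: (lt s).
exists (M + 1); split=> // c h; apply: ltW; apply/ext_pref_cst.
  exact: (ext_pref_trans _ Lp).
exact: (ext_pref_trans _ Lp).
Qed.

(** The inequality is strict because openness lets any [c] beaten by [phi] be raised a little, so
    the supremum is not attained. *)
Lemma ext_lowerP phi c : L phi -> (ext_pref phi (fun=> c) <-> c < ext_lower phi).
Proof.
move=> Lp; have [M [h1 h2 h3 h4]] := ext_bounds Lp.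
have hs : has_sup [set c | ext_pref phi (fun=> c)].
  by split; [exists (- M)|exists M => ? /h3].
split=> [/(ext_pref_openr Lp)[d d0 h]|lt].
  apply: lt_le_trans (_ : c + d <= _); first by rewrite ltrDl.
  by apply: ub_le_sup => //; case: hs.
have d0 : 0 < ext_lower phi - c by rewrite subr_gt0.
have [c' h] := sup_adherent d0 hs; rewrite subKr => cc'.
by apply: (ext_pref_mono_r Lp _ _ _ h) => // s; exact: ltW.
Qed.

Lemma ext_upperP phi c : L phi -> (ext_pref (fun=> c) phi <-> ext_upper phi < c).
Proof.
move=> Lp; have [M [h1 h2 h3 h4]] := ext_bounds Lp.
have hs : has_inf [set c | ext_pref (fun=> c) phi].
  by split; [exists M|exists (- M) => ? /h4].
split=> [/(ext_pref_openl Lp)[d d0 h]|lt].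
  apply: le_lt_trans (_ : _ <= c - d) _; last by rewrite gtrBl.
  by apply: ge_inf => //; case: hs.
have d0 : 0 < c - ext_upper phi by rewrite subr_gt0.
have [c' h] := inf_adherent d0 hs; rewrite addrC subrK => cc'.
by apply: (ext_pref_mono_l _ _ Lp _ h) => // s; exact: ltW.
Qed.

Lemma ext_lower_le_upper phi : L phi -> ext_lower phi <= ext_upper phi.
Proof.
move=> Lp; rewrite leNgt; apply/negP => lt.
pose c := (ext_lower phi + ext_upper phi) / 2.
have h1 : ext_pref phi (fun=> c) by apply/ext_lowerP => //; rewrite /c; lra.
have h2 : ext_pref (fun=> c) phi by apply/ext_upperP => //; rewrite /c; lra.
exact: (ext_pref_asym _ _ h1 h2).
Qed.

Let eq_lt (a b : R) : (forall c, c < a <-> c < b) -> a = b.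
Proof.
by move=> h; apply/eqP; rewrite eq_le !leNgt; apply/andP; split; apply/negP => /h;
  rewrite ltxx.
Qed.

Lemma ext_lower_scale a phi : 0 < a -> L phi ->
  ext_lower (fun s => a * phi s) = a * ext_lower phi.
Proof.
move=> a0 Lp; apply: eq_lt => c; rewrite -ext_lowerP; last exact: LZ.
have cE : (fun=> c) = (fun s : S => a * (c / a)).
  by apply/funext => s; field; exact/lt0r_neq0.
rewrite cE (ext_pref_scale a0 Lp (Lc (c / a))) ext_lowerP//.
by rewrite ltr_pdivrMr// mulrC.
Qed.

Lemma ext_lower_translate c phi : L phi ->
  ext_lower (fun s => phi s + c) = ext_lower phi + c.
Proof.
move=> Lp; apply: eq_lt => d; rewrite -ext_lowerP; last exact: LDc.
have dE : (fun=> d) = (fun s : S => (d - c) + c).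
  by apply/funext => s; rewrite subrK.
by rewrite dE (ext_pref_translate c Lp (Lc (d - c))) ext_lowerP// ltrBlDr.
Qed.

Lemma ext_lower_cst c : ext_lower (fun=> c) = c.
Proof. by apply: eq_lt => d; rewrite -ext_lowerP// ext_pref_cst. Qed.

Lemma expectation_like_ext_lower : expectation_like Sigma ext_lower.
Proof.
split; [split|split]; last exact: ext_lower_cst.
- move=> phi psi Lp Lq.
  (* A4 only compares two acts with the same constant, so both functions are first translated to
     have lower endpoint 0; their average then has a nonnegative one, and doubling gives
     superadditivity. *)
  pose phi' s := phi s - ext_lower phi; pose psi' s := psi s - ext_lower psi.
  have Lp' : L phi' by exact: LDc.
  have Lq' : L psi' by exact: LDc.
  have p0 : ext_lower phi' = 0 by rewrite ext_lower_translate// subrr.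
  have q0 : ext_lower psi' = 0 by rewrite ext_lower_translate// subrr.
  have Lm : L (fun s => 2^-1 * phi' s + (1 - 2^-1) * psi' s) by apply: LD; exact: LZ.
  have m0 : 0 <= ext_lower (fun s => 2^-1 * phi' s + (1 - 2^-1) * psi' s).
    rewrite leNgt; apply/negP => lt.
    have := @ext_pref_convex 2^-1 _ _
      (ext_lower (fun s => 2^-1 * phi' s + (1 - 2^-1) * psi' s)) Lp' Lq' half01w.
    by rewrite !ext_lowerP// p0 q0 ltxx => /(_ lt lt).
  have mE : (fun s => 2^-1 * phi' s + (1 - 2^-1) * psi' s) =
      (fun s => 2^-1 * (phi s + psi s) + 2^-1 * (- (ext_lower phi + ext_lower psi))).
    by apply/funext => s; rewrite /phi' /psi'; field.
  move: m0; rewrite mE ext_lower_translate; last by apply: LZ; exact: LD.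
  have h0 : 0 < (2^-1 : R) by lra.
  by rewrite (ext_lower_scale h0 (LD Lp Lq)); lra.
- move=> a phi; rewrite le_eqVlt => /predU1P[<- Lp|]; last exact: ext_lower_scale.
  by under eq_fun do rewrite mul0r; rewrite mul0r ext_lower_cst.
- move=> phi psi Lp Lq le; rewrite leNgt; apply/negP => /(ext_lowerP _ Lp) h.
  have : ext_pref psi (fun=> ext_lower psi) by exact: (ext_pref_mono_l Lp Lq).
  by rewrite ext_lowerP// ltxx.
Qed.

(** * The two endpoints determine the preference *)

Section Twofold.
Hypotheses (a6 : A6 Sigma X pref) (a7 : A7 Sigma X pref).

Let cst_realize c : exists2 M, 0 < M & forall l, 0 < l <= M ->
  exists2 x, X x & u x = l * c.
Proof.
have [M M0 MP] := realize (Lc c); have [s0 _] := extended_inhabited.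
by exists M => // l /MP[f [Xf _] uf]; exists (f s0).
Qed.

(* A6 makes phi and psi incomparable when one of the intervals
   [ext_lower, ext_upper] contains the other; A7 decides the remaining case. *)
Lemma ext_prefP phi psi : L phi -> L psi ->
  (ext_pref phi psi <->
   ext_lower psi < ext_lower phi /\ ext_upper psi < ext_upper phi).
Proof.
have suff7 : forall phi psi, L phi -> L psi ->
    ext_lower psi < ext_lower phi -> ext_upper psi < ext_upper phi ->
    ext_pref phi psi.
  move=> {}phi {}psi Lp Lq lo up.
  have [M M0 MP] := realize Lp; have [N N0 NP] := realize Lq.
  (* A7 is applied with [x] at the upper endpoint of [phi], incomparable to [f] but above [g], and
     [y] at the lower endpoint of [psi], incomparable to [g] but below [f]. *)
  have [W W0 WP] := cst_realize (ext_upper phi).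
  have [Q Q0 QP] := cst_realize (ext_lower psi).
  pose l := Num.min (Num.min M N) (Num.min W Q).
  have l0 : 0 < l by rewrite /l !lt_min M0 N0 W0.
  have [|f Ff uf] := MP l; first by rewrite l0 /l !ge_min lexx.
  have [|g Fg ug] := NP l; first by rewrite l0 /l !ge_min lexx !orbT.
  have [|x Xx ux] := WP l; first by rewrite l0 /l !ge_min lexx !orbT.
  have [|y Xy uy] := QP l; first by rewrite l0 /l !ge_min lexx !orbT.
  have ux' (s : S) : u (Defs.cst x s) = l * ext_upper phi by [].
  have uy' (s : S) : u (Defs.cst y s) = l * ext_lower psi by [].
  apply/(ext_prefE l0 Ff Fg uf ug); apply: (@a7 f g x y) => //.
  - split=> [/(ext_prefE l0 Ff (Fcst Xx) uf ux')|/(ext_prefE l0 (Fcst Xx) Ff ux' uf)].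
      by rewrite ext_lowerP//; have := ext_lower_le_upper Lp; lra.
    by rewrite ext_upperP// ltxx.
  - apply/(ext_prefE l0 (Fcst Xx) Fg ux' ug); exact/ext_upperP.
  - split=> [/(ext_prefE l0 Fg (Fcst Xy) ug uy')|/(ext_prefE l0 (Fcst Xy) Fg uy' ug)].
      by rewrite ext_lowerP// ltxx.
    by rewrite ext_upperP//; have := ext_lower_le_upper Lq; lra.
  - apply/(ext_prefE l0 Ff (Fcst Xy) uf uy'); exact/ext_lowerP.
have nested : forall phi psi, L phi -> L psi ->
    ext_lower psi <= ext_lower phi -> ext_upper phi <= ext_upper psi ->
    ~ ext_pref phi psi /\ ~ ext_pref psi phi.
  move=> {}phi {}psi Lp Lq lo up.
  have [l [f [g [l0 Ff Fg uf ug]]]] := realize2 Lp Lq.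
  rewrite (ext_prefE l0 Ff Fg uf ug) (ext_prefE l0 Fg Ff ug uf).
  apply: a6 => // x Xx; have ux (s : S) : u (Defs.cst x s) = l * (u x / l).
    by rewrite /Defs.cst; field; exact/lt0r_neq0.
  rewrite /indiff -(ext_prefE l0 Ff (Fcst Xx) uf ux).
  rewrite -(ext_prefE l0 (Fcst Xx) Ff ux uf) -(ext_prefE l0 Fg (Fcst Xx) ug ux).
  rewrite -(ext_prefE l0 (Fcst Xx) Fg ux ug) !ext_lowerP// !ext_upperP//.
  move=> [/negP + /negP]; rewrite -!leNgt => h1 h2.
  by split; apply/negP; rewrite -leNgt; lra.
move=> Lp Lq; split; last by case=> lo up; exact: suff7.
move=> h.
have [lo|lo|lo] := ltgtP (ext_lower psi) (ext_lower phi).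
- split=> //; rewrite ltNge; apply/negP => up.
  by have [] := nested _ _ Lp Lq (ltW lo) up.
- have [up|up] := leP (ext_upper psi) (ext_upper phi).
    by have [] := nested _ _ Lq Lp (ltW lo) up.
  by exfalso; apply: (ext_pref_asym Lp Lq h); exact: suff7.
- have le1 : ext_lower phi <= ext_lower psi by rewrite lo.
  have le2 : ext_lower psi <= ext_lower phi by rewrite lo.
  have [up|up] := leP (ext_upper psi) (ext_upper phi).
    by have [] := nested _ _ Lq Lp le1 up.
  by have [] := nested _ _ Lp Lq le2 (ltW up).
Qed.

(** The profiles [- phi] and [phi + 2 * k] are complementary with midpoint [k]. A8 and A9 equate
    [k < ext_lower (- phi)] with the midpoint beating [phi + 2 * k], which after translation says
    that [- k] beats [phi]. *)
Lemma ext_upperE phi : A8 Sigma X pref -> A9 Sigma X pref -> L phi ->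
  ext_upper phi = - ext_lower (fun s => - phi s).
Proof.
move=> a8 a9 Lp; apply/eqP; rewrite -eqr_oppLR; apply/eqP; apply: eq_lt => k.
have LNp := LN Lp.
have LkN : L (fun s => 2 * k - - phi s).
  by apply: (LD (Lc _)); exact: LN.
have [l [f [g [l0 Ff Fg uf ug]]]] := realize2 LNp LkN.
have [Xf _] := Ff; have [Xg _] := Fg.
have comp : complementary pref f g.
  move=> s s'; have [X1 u1] := affine_half convX uaff (Xf s) (Xg s).
  have [X2 u2] := affine_half convX uaff (Xf s') (Xg s').
  by split; rewrite uP// u1 u2 !uf !ug; lra.
have Fm := Fmix Ff Fg half01w.
have um s : u (mix 2^-1 f g s) = l * k by rewrite umix// uf ug; field.
have := @a8 f g Ff Fg comp; have := @a9 f g Ff Fg comp.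
rewrite -(ext_prefE l0 Ff Fm uf um) -(ext_prefE l0 Fm Fg um ug).
rewrite ext_lowerP//.
have kE : (fun=> k) = (fun s : S => - k + 2 * k) by apply/funext => s; ring.
have gE : (fun s => 2 * k - - phi s) = (fun s => phi s + 2 * k).
  by apply/funext => s; ring.
rewrite kE gE (ext_pref_translate (2 * k) (Lc (- k)) Lp) ext_upperP//.
by move=> h1 h2; split; [move=> h; apply: h1; lra|move=> /h2; lra].
Qed.

End Twofold.
End ExtendedPreference.

(** * Characterization and uniqueness *)

Section Characterization.
Variables (R : realType) (V : lmodType R) (S : Type).
Variables (Sigma : set (set S)) (X : set V).
Hypotheses (algS : is_algebra Sigma) (convX : convex_subset X).
Notation F := (simple_act Sigma X).
Notation L := (@simple_fun S Sigma R).
Variable pref : (S -> V) -> (S -> V) -> Prop.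

Lemma normalized_utility :
  A1 Sigma X pref -> A2 Sigma X pref -> A3 Sigma X pref ->
  exists u e, [/\ affine_on X u, nonconstant_on X u,
    forall x y, X x -> X y -> (pref (Defs.cst x) (Defs.cst y) <-> u y < u x) &
    forall r : R, `|r| <= 1 -> X (e r) /\ u (e r) = r].
Proof.
move=> a1 a2 a3; have [asym [_ [[x1 [x0 [Xx1 [Xx0 P10]]]] ntrans]]] := a1.
have Fc : forall x, X x -> F (Defs.cst x) by exact: simple_act_cst.
have [v vaff vP] : exists2 v, affine_on X v & forall x y, X x -> X y ->
    (pref (Defs.cst x) (Defs.cst y) <-> v y < v x).
  apply: (@expected_utility _ _ _ convX
    (fun x y => pref (Defs.cst x) (Defs.cst y)) _ _ _ _ x1 x0) => //.
  - by move=> x y Xx Xy; apply: asym; exact: Fc.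
  - by move=> x y z Xx Xy Xz; exact: (a2 _ _ _ (Fc _ Xx) (Fc _ Xy) (Fc _ Xz)).
  - by move=> x y z a Xx Xy Xz; exact: (a3 _ _ _ _ (Fc _ Xx) (Fc _ Xy) Xz).
have v10 := (vP _ _ Xx1 Xx0).1 P10.
have vnc : nonconstant_on X v.
  by exists x1, x0; split=> //; split=> // E; rewrite E ltxx in v10.
have [e [c [d [d0 eP]]]] := affine_segment convX vaff vnc.
have dn0 := lt0r_neq0 d0.
exists (fun x => (v x - c) / d), e; split.
- by move=> x y a Xx Xy a01; rewrite vaff//; field.
- exists x1, x0; split=> //; split=> //.
  move=> /(mulIf (invr_neq0 dn0))/(addIr (- c)) E.
  by rewrite E ltxx in v10.
- by move=> x y Xx Xy; rewrite vP// ltr_pM2r ?invr_gt0// ltrD2r.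
- by move=> r /eP[Xe ->]; split=> //; field.
Qed.

Lemma axioms_dual_rep :
  A1 Sigma X pref -> A2 Sigma X pref -> A3 Sigma X pref -> A4 Sigma X pref ->
  A5 Sigma X pref -> A6 Sigma X pref -> A7 Sigma X pref -> A8 Sigma X pref ->
  A9 Sigma X pref ->
  exists u I, [/\ affine_on X u, nonconstant_on X u, expectation_like Sigma I &
                  dual_rep Sigma X pref u I I].
Proof.
move=> a1 a2 a3 a4 a5 a6 a7 a8 a9.
have [u [e [uaff unc uP eP]]] := normalized_utility a1 a2 a3.
exists u, (ext_lower Sigma X pref u); split=> //.
  exact: (expectation_like_ext_lower algS convX a1 a2 a3 a4 a5 uaff uP eP).
move=> f g Ff Fg.
have Lf := simple_act_comp algS u Ff; have Lg := simple_act_comp algS u Fg.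
rewrite (ext_pref_act algS convX a1 a2 a3 a5 uaff uP eP Ff Fg).
rewrite (ext_prefP algS convX a1 a2 a3 a5 uaff uP eP a6 a7 Lf Lg).
rewrite (ext_upperE algS convX a1 a2 a3 a5 uaff uP eP a8 a9 Lf).
by rewrite (ext_upperE algS convX a1 a2 a3 a5 uaff uP eP a8 a9 Lg) ltrN2.
Qed.

Lemma dual_rep_HP_rep u I : affine_on X u -> nonconstant_on X u ->
  expectation_like Sigma I -> dual_rep Sigma X pref u I I ->
  exists C, HP_rep Sigma X pref u C C.
Proof.
move=> uaff unc eI rep; exists (core Sigma I).
have gC := good_core algS I; have [CP _] := gC.
split=> //; split=> //; split=> //; split=> //; split.
  have [p Ip _] := core_attained algS eI (simple_fun_cst algS 0).
  by exists p; split.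
move=> f g Ff Fg; have [_ sf] := Ff; have [_ sg] := Fg.
have Lf := simple_act_comp algS u Ff; have Lg := simple_act_comp algS u Fg.
rewrite (rep f g Ff Fg) !(minE_lower_env algS CP)// !(maxE_lower_env algS CP)//.
rewrite (ltrN2 (lower_env _ _) (lower_env _ _)).
rewrite (lower_env_core algS eI (simple_funN algS Lf)).
rewrite (lower_env_core algS eI (simple_funN algS Lg)).
by rewrite (lower_env_core algS eI Lf) (lower_env_core algS eI Lg).
Qed.

(** [v] is constant on the level sets of [u], so [q] can be replaced by a point of the segment from
    [p] to [r] with the same utility. The cross-multiplied form also covers [u p = u r]. *)
Lemma affine_interpolate (u v : V -> R) p q r : affine_on X u -> affine_on X v ->
  (forall x y, X x -> X y -> (u y < u x <-> v y < v x)) ->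
  X p -> X q -> X r -> u p <= u q <= u r ->
  v q * (u r - u p) = v r * (u q - u p) + v p * (u r - u q).
Proof.
move=> uaff vaff uv Xp Xq Xr /andP[pq qr].
have same x y : X x -> X y -> u x = u y -> v x = v y.
  move=> Xx Xy E; apply/eqP; rewrite eq_le !leNgt.
  apply/andP; split; apply/negP.
    by move=> /(uv _ _ Xx Xy); rewrite E ltxx.
  by move=> /(uv _ _ Xy Xx); rewrite E ltxx.
have [E|ne] := eqVneq (u p) (u r).
  have Eq : u q = u p by apply/eqP; rewrite eq_le pq E qr.
  by rewrite Eq -E subrr !mulr0 addr0.
have d0 : 0 < u r - u p by rewrite subr_gt0 lt_neqAle ne (le_trans pq).
pose t := (u q - u p) / (u r - u p).
have t01 : 0 <= t <= 1.
  by rewrite /t ler_pdivrMr// mul1r lerD2r qr andbT divr_ge0 ?(ltW d0)// subr_ge0.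
have : v q = v (t *: r + (1 - t) *: p).
  apply: same => //; first exact: convX.
  by rewrite uaff// /t; field; exact/lt0r_neq0.
by rewrite vaff// => ->; rewrite /t; field; exact/lt0r_neq0.
Qed.

Lemma affine_unique (u v : V -> R) : affine_on X u -> affine_on X v ->
  nonconstant_on X u ->
  (forall x y, X x -> X y -> (u y < u x <-> v y < v x)) ->
  pos_affine_transf X u v.
Proof.
move=> uaff vaff [x1 [x0 [X1 [X0 ne]]]] uv.
wlog lt : x1 x0 X1 X0 ne / u x0 < u x1.
  move=> h; have [lt|lt|//] := ltgtP (u x1) (u x0); last exact: (h x1 x0).
  by apply: (h x0 x1) => // /esym.
have lt' := (uv _ _ X1 X0).1 lt.
have d0 : 0 < u x1 - u x0 by rewrite subr_gt0.
have dn0 := lt0r_neq0 d0.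
exists ((v x1 - v x0) / (u x1 - u x0)).
exists (v x0 - (v x1 - v x0) / (u x1 - u x0) * u x0).
split; first by rewrite divr_gt0// subr_gt0.
move=> x Xx.
suff E : v x * (u x1 - u x0) = v x1 * (u x - u x0) + v x0 * (u x1 - u x).
  by apply: (mulIf dn0); rewrite E; field.
(* Interpolation concerns the middle of three points, which may be [x0], [x] or [x1]; the three
   resulting identities are the same linear relation. *)
have ip := affine_interpolate uaff vaff uv.
have [h|h] := leP (u x0) (u x); last first.
  have := ip _ _ _ Xx X0 X1; rewrite !ltW// => /(_ isT); lra.
have [h'|h'] := leP (u x) (u x1); first by apply: ip => //; rewrite h.
by have := ip _ _ _ X0 X1 Xx; rewrite !ltW// => /(_ isT); lra.
Qed.

Lemma HP_rep_unique u C u' C' : HP_rep Sigma X pref u C C ->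
  HP_rep Sigma X pref u' C' C' -> pos_affine_transf X u u' /\ C' = C.
Proof.
move=> h h'; have [uaff [unc [gC [_ [CC _]]]]] := h.
have [uaff' [unc' [gC' [_ [CC' _]]]]] := h'.
have [eI _ II rep] := HP_rep_dual algS h.
have [eI' _ II' rep'] := HP_rep_dual algS h'.
have C0 : C !=set0 by case: CC => p [Cp _]; exists p.
have C0' : C' !=set0 by case: CC' => p [Cp _]; exists p.
have pos : pos_affine_transf X u u'.
  apply: affine_unique => // x y Xx Xy.
  rewrite -(dual_rep_cst algS eI eI II rep Xx Xy).
  exact: (dual_rep_cst algS eI' eI' II' rep' Xx Xy).
split=> //; have [a [b [a0 u'E]]] := pos.
(* Comparisons with constants determine the envelope at an act whose profile is [c + d * phi];
   translation and homogeneity carry the equality back to [phi]. *)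
have eqI phi : L phi -> lower_env C phi = lower_env C' phi.
  move=> Lp.
  have [f [_ [c [d [Ff _ _ d0 [fE _]]]]]] :=
    dual_rep_complementary_ex algS convX uaff unc eI eI II rep 0 Lp.
  have Lf := simple_act_comp algS u Ff; have [Xf _] := Ff.
  have u'f : (fun s => u' (f s)) = (fun s => a * u (f s) + b).
    by apply/funext => s; rewrite u'E.
  have I'E : lower_env C' (fun s => u' (f s)) =
      a * lower_env C' (fun s => u (f s)) + b.
    rewrite u'f (expectation_like_translate algS b eI' (simple_funZ algS a Lf)).
    by case: eI' => -[_ ->]//; exact: ltW.
  have gt x : X x -> (u x < lower_env C (fun s => u (f s)) <->
                      u x < lower_env C' (fun s => u (f s))).
    move=> Xx; rewrite -(dual_rep_gt_cst algS eI eI II rep Ff Xx).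
    rewrite (dual_rep_gt_cst algS eI' eI' II' rep' Ff Xx) I'E u'E//.
    by rewrite ltrD2r ltr_pM2l.
  (* The range of [u] need not be the whole line, so the two envelope values can be compared through
     [gt] only because each is the utility of some point of [X]. *)
  have [[x Xx xI] _] := dual_rep_attained algS convX uaff eI eI Ff.
  have [[y Xy yI] _] := dual_rep_attained algS convX uaff' eI' eI' Ff.
  have yI' : u y = lower_env C' (fun s => u (f s)).
    by move: yI; rewrite I'E u'E// => /addIr/(mulfI (lt0r_neq0 a0)).
  have E : lower_env C (fun s => u (f s)) = lower_env C' (fun s => u (f s)).
    apply/eqP; rewrite eq_le !leNgt; apply/andP; split; apply/negP.
      by rewrite -yI' => /(gt _ Xy); rewrite yI' ltxx.
    by rewrite -xI => /(gt _ Xx); rewrite xI ltxx.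
  have fE' : (fun s => u (f s)) = (fun s => d * phi s + c).
    by apply/funext => s; rewrite fE addrC.
  move: E; rewrite fE'.
  rewrite (expectation_like_translate algS c eI (simple_funZ algS d Lp)).
  rewrite (expectation_like_translate algS c eI' (simple_funZ algS d Lp)).
  have [[_ Iz] _] := eI; have [[_ Iz'] _] := eI'.
  by rewrite (Iz _ _ (ltW d0) Lp) (Iz' _ _ (ltW d0) Lp) => /addIr/(mulfI (lt0r_neq0 d0)).
apply/seteqP; split.
  apply/(lower_env_le_subset algS C0 C0' gC gC') => phi Lp.
  by rewrite eqI.
apply/(lower_env_le_subset algS C0' C0 gC' gC) => phi Lp.
by rewrite eqI.
Qed.

End Characterization.

Theorem theorem2 (R : realType) (V : lmodType R) (X : set V) (S : Type)
    (Sigma : set (set S)) :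
  is_algebra Sigma -> convex_subset X -> nonsingleton X ->
  (forall (pref : (S -> V) -> (S -> V) -> Prop) (u : V -> R)
          (C D : set (set S -> R)),
     HP_rep Sigma X pref u C D -> HP_unique Sigma X pref u C D ->
     (A8 Sigma X pref <-> D `<=` C) /\ (A9 Sigma X pref <-> C `<=` D)) /\
  (forall pref : (S -> V) -> (S -> V) -> Prop,
     (A1 Sigma X pref /\ A2 Sigma X pref /\ A3 Sigma X pref /\
      A4 Sigma X pref /\ A5 Sigma X pref /\ A6 Sigma X pref /\
      A7 Sigma X pref /\ A8 Sigma X pref /\ A9 Sigma X pref) <->
     exists (u : V -> R) (C : set (set S -> R)),
       HP_rep Sigma X pref u C C /\
       forall u' C', HP_rep Sigma X pref u' C' C' ->
         pos_affine_transf X u u' /\ C' = C).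
Proof.
move=> algS convX _; split.
  move=> pref u C D h _; have [uaff [unc [gC [gD [[p [Cp Dp]] _]]]]] := h.
  have C0 : C !=set0 by exists p.
  have D0 : D !=set0 by exists p.
  have [eC eD CD rep] := HP_rep_dual algS h; split.
    rewrite (dual_rep_A8 algS convX uaff unc eC eD CD rep).
    exact: lower_env_le_subset.
  rewrite (dual_rep_A9 algS convX uaff unc eC eD CD rep).
  exact: lower_env_le_subset.
move=> pref; split.
  move=> [a1 [a2 [a3 [a4 [a5 [a6 [a7 [a8 a9]]]]]]]].
  have [u [I [uaff unc eI rep]]] :=
    axioms_dual_rep algS convX a1 a2 a3 a4 a5 a6 a7 a8 a9.
  have [C h] := dual_rep_HP_rep algS uaff unc eI rep.
  by exists u, C; split=> // u' C' h'; exact: (HP_rep_unique algS convX h h').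
move=> [u [C [h _]]]; have [uaff [unc _]] := h.
have [eC _ CD rep] := HP_rep_dual algS h.
split; first exact: (dual_rep_A1 algS unc eC eC CD rep).
split; first exact: (dual_rep_A2 algS convX uaff eC eC rep).
split; first exact: (dual_rep_A3 algS convX uaff eC eC rep).
split; first exact: (dual_rep_A4 algS convX uaff eC eC CD rep).
split; first exact: (dual_rep_A5 algS eC eC CD rep).
split; first exact: (dual_rep_A6 algS convX uaff eC eC CD rep).
split; first exact: (dual_rep_A7 algS eC eC CD rep).
by split; [apply/(dual_rep_A8 algS convX uaff unc eC eC CD rep)|
           apply/(dual_rep_A9 algS convX uaff unc eC eC CD rep)].
Qed.
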